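(* For all $\lambda>0$ and all $x>0$, $$\mathbb{P}\left(\left|\frac{\tau(\hat f)}{R_0}-1\right|\ge x\right)\le 3\exp\left(-\frac{x^4(\sqrt n R_0)^2}{32(1+x)^2}\right).$$
   Context: Setting. Let $n\ge 1$, let $x_1,\dots,x_n$ be given (fixed) points of a space $\mathcal X$, and let $Y_i=f^0(x_i)+\epsilon_i$, $i=1,\dots,n$, where $\epsilon_1,\dots,\epsilon_n$ are independent standard Gaussian random variables. $\mathcal F=\{f:\mathcal I(f)<\infty\}$ is a vector space of real functions on $\mathcal X$ on which $\mathcal I$ is a (finite) seminorm, and $f^0\in\mathcal F$ is a fixed unknown function. For $u,v\in\mathbb R^n$, $\langle u,v\rangle$ is the usual inner product and $\|u\|_n^2:=u^Tu/n$. A function $f$ is identified with the vector $(f(x_1),\dots,f(x_n))^T$ whenever it appears in $\|\cdot\|_n$ or $\langle\cdot,\cdot\rangle$; $Y=(Y_1,\dots,Y_n)^T$, $\epsilon=(\epsilon_1,\dots,\epsilon_n)^T$. For a tuning parameter $\lambda>0$, the penalized least squares estimator is $$\hat f:=\arg\min_{f\in\mathcal F}\{\|Y-f\|_n^2+\lambda^2\mathcal I^2(f)\},$$ which is assumed to exist and be unique. For $f\in\mathcal F$ let $\tau(f):=\sqrt{\|f-f^0\|_n^2+\lambda^2\mathcal I^2(f)}$, and let $R_{min}:=\min_{f\in\mathcal F}\tau(f)$, which is assumed to be attained. For $R\ge R_{min}$ define $\mathcal F(R):=\{f\in\mathcal F:\tau(f)\le R\}$, $M_n(R):=\sup_{f\in\mathcal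 F(R)}\langle\epsilon,f-f^0\rangle/n$, $M(R):=\mathbb E M_n(R)$, $H_n(R):=M_n(R)-R^2/2$, $H(R):=\mathbb E H_n(R)$. The nonrandom quantity $R_0$ is the unique maximizer of $H$: $R_0:=\arg\max_{R\ge R_{min}}H(R)$. *)

(* Defs.v *)
From HB Require Import structures.
From mathcomp Require Export all_boot all_order all_algebra.
From mathcomp Require Export all_classical all_reals all_analysis.
Export Order.TTheory GRing.Theory Num.Theory.
Export numFieldNormedType.Exports.

#[export] Set Implicit Arguments.
#[export] Unset Strict Implicit.
#[export] Unset Printing Implicit Defensive.

Local Open Scope classical_set_scope.
Local Open Scope ring_scope.

Definition unique_argmin {d} {A : Type} {B : porderType d}
    (D : set A) (F : A -> B) (a : A) : Prop :=
  D a /\ forall b, D b -> b <> a -> (F a < F b)%O.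

Definition unique_argmax {d} {A : Type} {B : porderType d}
    (D : set A) (F : A -> B) (a : A) : Prop :=
  D a /\ forall b, D b -> b <> a -> (F b < F a)%O.

(* Only measurable sets are tested: on other sets both sides are junk. *)
Definition standard_gaussian {d} {T : measurableType d} {R : realType}
    {P : probability T R} (X : {RV P >-> R}) : Prop :=
  forall A : set R, measurable A -> distribution P X A = normal_prob 0 1 A.

Definition mutually_independent {d} {T : measurableType d} {R : realType}
    {P : probability T R} {n : nat} (X : 'I_n -> {RV P >-> R}) : Prop :=
  forall (J : {set 'I_n}) (A : 'I_n -> set R),
    (forall i, i \in J -> measurable (A i)) ->
    P [set w | forall i, i \in J -> A i (X i w)]
    = (\prod_(i in J) P [set w | A i (X i w)])%E.

Section regularized_least_squares.
Context {R : realType} {X : Type} {n : nat}.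
Implicit Types (f : X -> R) (u v : 'cV[R]_n).

(* The penalty is extended-valued on all functions, its finiteness domain being
   the model class. *)
Definition finite_penalty (I : (X -> R) -> \bar R) : set (X -> R) :=
  [set f | (I f < +oo)%E].

Record seminorm_on_domain (I : (X -> R) -> \bar R) : Prop := SeminormOnDomain {
  domain0 : finite_penalty I (fun=> 0);
  domainD : forall f g, finite_penalty I f -> finite_penalty I g ->
    finite_penalty I (fun z => f z + g z);
  domainZ : forall (a : R) f, finite_penalty I f ->
    finite_penalty I (fun z => a * f z);
  penalty_ge0 : forall f, (0 <= I f)%E;
  penaltyD : forall f g, finite_penalty I f -> finite_penalty I g ->
    (I (fun z => f z + g z)%R <= I f + I g)%E;
  penaltyZ : forall (a : R) f, finite_penalty I f ->
    I (fun z => a * f z)%R = (`|a|%:E * I f)%E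
}.

Definition dot u v : R := \sum_i u i 0 * v i 0.

Definition sqnorm_n u : R := dot u u / n%:R.

Definition at_points (xs : 'I_n -> X) f : 'cV[R]_n := \col_i f (xs i).

Definition penalized_loss (I : (X -> R) -> \bar R) (xs : 'I_n -> X)
    (lambda : R) (y : 'cV[R]_n) f : R :=
  sqnorm_n (y - at_points xs f) + lambda ^+ 2 * fine (I f) ^+ 2.

Definition tau (I : (X -> R) -> \bar R) (xs : 'I_n -> X) (lambda : R)
    (f0 f : X -> R) : R :=
  Num.sqrt (sqnorm_n (at_points xs f - at_points xs f0)
            + lambda ^+ 2 * fine (I f) ^+ 2).

Definition Rmin (I : (X -> R) -> \bar R) (xs : 'I_n -> X) (lambda : R)
    (f0 : X -> R) : R :=
  inf [set tau I xs lambda f0 f | f in finite_penalty I].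

Definition tau_ball (I : (X -> R) -> \bar R) (xs : 'I_n -> X) (lambda : R)
    (f0 : X -> R) (r : R) : set (X -> R) :=
  [set f | finite_penalty I f /\ tau I xs lambda f0 f <= r].

Section random.
Context {d : measure_display} {T : measurableType d} {P : probability T R}.
Variable eps : 'I_n -> {RV P >-> R}.

Definition noise (w : T) : 'cV[R]_n := \col_i eps i w.

Definition response (xs : 'I_n -> X) (f0 : X -> R) (w : T) : 'cV[R]_n :=
  at_points xs f0 + noise w.

Variables (I : (X -> R) -> \bar R) (xs : 'I_n -> X) (lambda : R) (f0 : X -> R).

Definition Mn (r : R) (w : T) : R :=
  sup [set dot (noise w) (at_points xs f - at_points xs f0) / n%:R
      | f in tau_ball I xs lambda f0 r].

Definition Hn (r : R) (w : T) : R := Mn r w - r ^+ 2 / 2.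

Definition H (r : R) : \bar R := 'E_P[Hn r].

End random.
End regularized_least_squares.

(* Main.v *)
(** [tau fhat] maximizes [r |-> M_n r - r ^+ 2 / 2], where [M_n] is concave in [r];
    the mean [H] of this function drops by at least [(r - R0) ^+ 2 / 2] away from
    [R0]. Hence, if [tau fhat] lies beyond [r] as seen from [R0], the increment
    [M_n r - M_n R0] exceeds its mean by [(r - R0) ^+ 2 / 2].

    Strong convexity of [tau ^+ 2] makes this increment Lipschitz in the noise
    with squared constant [|r ^+ 2 - R0 ^+ 2| / n], whereas its two terms
    separately have squared constants [r ^+ 2 / n] and [R0 ^+ 2 / n]. This gain
    pays for using the deviation bound [exp (- t ^+ 2 / (4 K))] for functions with
    squared Lipschitz constant [K] in place of the sharp [exp (- t ^+ 2 / (2 K))].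

    That deviation bound comes from Maurey's property (tau): if
    [u x * v y <= exp (|x - y| ^+ 2 / 4)], then [E u * E v <= 1] under the
    standard Gaussian law. It tensorizes by Fubini, and in dimension one it is
    the Prekopa-Leindler inequality for the Gaussian density. *)
Require Import Defs.
From HB Require Import structures.
From mathcomp Require Import ring lra measurable_realfun.
Local Open Scope classical_set_scope.
Local Open Scope ring_scope.

(** * Measurability of comparison events *)

Lemma measurable_set_ltr {d} {T : measurableType d} {R : realType}
    (f g : T -> R) : measurable_fun setT f -> measurable_fun setT g ->
  measurable [set x | f x < g x].
Proof.
move=> mf mg; rewrite -[X in measurable X]setTI.
exact: (measurable_fun_ltr mf mg measurableT (Y := [set true])).
Qed.

Lemma measurable_set_ler {d} {T : measurableType d} {R : realType}
    (f g : T -> R) : measurable_fun setT f -> measurable_fun setT g ->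
  measurable [set x | f x <= g x].
Proof.
move=> mf mg; rewrite -[X in measurable X]setTI.
exact: (measurable_fun_ler mf mg measurableT (Y := [set true])).
Qed.

(** * Property (tau) of the standard Gaussian law *)

Lemma measurable_subgraph {R : realType} (f : R -> R) :
  measurable_fun [set: R] f ->
  measurable [set p : R * R | 0 < p.2 < f p.1].
Proof.
move=> mf; set B := [set p | _].
have -> : B = [set p : R * R | 0 < p.2] `&` [set p | p.2 < f p.1].
  by apply/seteqP; split => p; rewrite /B/=; [case/andP|case=> -> ->].
have mf1 : measurable_fun setT (fun p : R * R => f p.1).
  exact: measurableT_comp.
by apply: measurableI; exact: measurable_set_ltr.
Qed.

(** Both sides are the area under the graph of [f], computed by Tonelli in the two orders from the
    indicator of the subgraph. *)
Lemma layer_cake {R : realType} (f : R -> R) :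
  measurable_fun [set: R] f -> (forall x, 0 <= f x) ->
  (\int[lebesgue_measure]_x (f x)%:E =
   \int[lebesgue_measure]_t lebesgue_measure [set x | (0 < t < f x)%R])%E.
Proof.
move=> mf f0.
pose B := [set p : R * R | 0 < p.2 < f p.1].
have mB : measurable B by exact: measurable_subgraph.
transitivity (\int[lebesgue_measure]_x \int[lebesgue_measure]_t
    (EFin \o (\1_B : R * R -> R)) (x, t))%E.
  apply: eq_integral => x _.
  rewrite (_ : (fun t => (\1_B (x, t))%:E) = EFin \o \1_(`]0, f x[%classic)).
    rewrite integral_indic//= setIT lebesgue_measure_itv/= lte_fin.
    by case: ltgtP (f0 x) => // [|<-] _; rewrite ?oppr0 ?adde0 ?sube0.
  by apply/funext => t /=; rewrite !indicE; congr (_ %:R%:E); apply/idP/idP;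
    rewrite !inE /= in_itv.
have mB1 : measurable_fun setT (EFin \o (\1_B : R * R -> R)).
  exact/measurable_EFinP/measurable_indic.
have B0 (p : R * R) : (0 <= (EFin \o (\1_B : R * R -> R)) p)%E
  by rewrite lee_fin.
rewrite (fubini_tonelli (m1 := @lebesgue_measure R) (m2 := @lebesgue_measure R)
  _ mB1 B0).
apply: eq_integral => t _.
rewrite (_ : (fun x => (\1_B (x, t))%:E) =
    EFin \o \1_[set x | (0 < t < f x)%R]).
  rewrite integral_indic//= ?setIT//.
  have -> : [set x | 0 < t < f x] = ysection B t.
    by apply/seteqP; split => x; rewrite /ysection/= !inE.
  exact: measurable_ysection.
by apply/funext => x /=; rewrite !indicE; congr (_ %:R%:E); apply/idP/idP;
  rewrite !inE.
Qed.

Lemma measurable_layer {R : realType} (f : R -> R) :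
  measurable_fun [set: R] f ->
  measurable_fun [set: R]
    (fun t => lebesgue_measure [set x | (0 < t < f x)%R]).
Proof.
move=> mf; pose B := [set p : R * R | 0 < p.2 < f p.1].
have mB : measurable B by exact: measurable_subgraph.
rewrite (_ : (fun t => _) = lebesgue_measure \o ysection B).
  exact: measurable_fun_ysection.
apply/funext => t /=; congr lebesgue_measure.
by apply/seteqP; split => x; rewrite /ysection/= !inE.
Qed.

(** One-dimensional Brunn-Minkowski when [A + B] lies in a symmetric interval: [A] and [B] are no
    longer than their convex hulls, and the constraint on [x + y] passes to the sums of the suprema
    and of the infima. *)
Lemma lebesgue_measure_add_le {R : realType} (A B : set R) (r : R) :
  measurable A -> measurable B -> A !=set0 -> B !=set0 ->
  (forall x y, A x -> B y -> `|x + y| < 2 * r) ->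
  (lebesgue_measure A + lebesgue_measure B <= (4 * r)%:E)%E.
Proof.
move=> mA mB [a Aa] [b Bb] AB.
have AB1 x y : A x -> B y -> - (2 * r) < x + y /\ x + y < 2 * r.
  by move=> Ax By; have := AB _ _ Ax By; rewrite ltr_norml => /andP.
have supA : has_sup A.
  by split; [exists a|exists (2 * r - b) => x /AB1 /(_ Bb) []; lra].
have supB : has_sup B.
  by split; [exists b|exists (2 * r - a) => x /(AB1 _ _ Aa) []; lra].
have infA : has_inf A.
  by split; [exists a|exists (- (2 * r) - b) => x /AB1 /(_ Bb) []; lra].
have infB : has_inf B.
  by split; [exists b|exists (- (2 * r) - a) => x /(AB1 _ _ Aa) []; lra].
have le_len (C : set R) : measurable C -> C !=set0 -> has_sup C -> has_inf C ->
    (lebesgue_measure C <= (sup C - inf C)%:E)%E.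
  move=> mC [c Cc] supC infC.
  have h : C `<=` `[inf C, sup C]%classic.
    move=> x Cx /=; rewrite in_itv /= ge_inf//=; last by case: infC.
    by apply: sup_upper_bound.
  apply: (@le_trans _ _ (lebesgue_measure `[inf C, sup C]%classic)).
    by apply: le_measure => //; rewrite inE.
  rewrite lebesgue_measure_itv /= lte_fin; case: ifPn => //.
  rewrite lee_fin subr_ge0 => _; apply: (@le_trans _ _ c).
    by rewrite ge_inf//; case: infC.
  by apply: sup_upper_bound.
have s1 : sup A + sup B <= 2 * r.
  rewrite -lerBrDr; apply: ge_sup; first by exists a.
  move=> x Ax; rewrite lerBrDr -lerBrDl; apply: ge_sup; first by exists b.
  by move=> y By; have [] := AB1 _ _ Ax By; lra.
have s2 : - (2 * r) <= inf A + inf B.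
  rewrite -lerBlDr; apply: lb_le_inf; first by exists a.
  move=> x Ax; rewrite lerBlDr -lerBlDl; apply: lb_le_inf; first by exists b.
  by move=> y By; have [] := AB1 _ _ Ax By; lra.
apply: (le_trans (leeD (le_len A mA _ supA infA) (le_len B mB _ supB infB))).
- by exists a.
- by exists b.
by rewrite -EFinD lee_fin; lra.
Qed.

(** The Radon-Nikodym derivative and [normal_pdf] have the same integral over every measurable set,
    hence agree almost everywhere. *)
Lemma ge0_integral_normal_prob {R : realType} (m s : R) (f : R -> \bar R) :
  measurable_fun [set: R] f -> (forall x, 0 <= f x)%E ->
  (\int[normal_prob m s]_x f x =
   \int[lebesgue_measure]_x (f x * (normal_pdf m s x)%:E))%E.
Proof.
move=> mf f0.
rewrite -(Radon_Nikodym_SigmaFinite.change_of_variables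
  (normal_prob_dominates m s))//.
have nd := normal_prob_dominates m s.
have ifn := Radon_Nikodym_SigmaFinite.f_integrable nd.
apply: ae_eq_integral => //.
- apply: emeasurable_funM => //; exact: measurable_int ifn.
- apply: emeasurable_funM => //; apply/measurable_EFinP.
  exact: measurable_normal_pdf.
- apply: ae_eqe_mul2l => /=.
  apply: integral_ae_eq => //=.
  + by apply/measurable_EFinP; exact: measurable_normal_pdf.
  + by move=> E _ mE; rewrite -Radon_Nikodym_SigmaFinite.f_integral.
Qed.

(** The superlevel set is an interval []-r, r[], since the density decreases in the modulus; the
    hypothesis confines [x + y] to twice this interval. *)
Lemma level_set_le {R : realType} (A B : set R) (s : R) :
  measurable A -> measurable B -> A !=set0 -> B !=set0 -> 0 < s ->
  (forall x y, A x -> B y -> s < normal_pdf 0 1 ((x + y) / 2)) ->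
  (lebesgue_measure A + lebesgue_measure B <=
   2%:E * lebesgue_measure [set z : R | (s < normal_pdf 0 1 z)%R])%E.
Proof.
move=> mA mB A0 B0 s0 AB.
have n1 : (1 : R) != 0 by exact: oner_neq0.
set K : R := normal_peak 1.
have K0 : 0 < K by exact: normal_peak_gt0.
(* The squared radius: [s < K * expR (- z ^+ 2 / 2)] means [z ^+ 2 < q]. *)
pose q := - ln (s / K) * 2.
have pdfq z : s < normal_pdf 0 1 z <-> z ^+ 2 < q.
  rewrite normal_pdfE// /normal_fun subr0 expr1n -/K mulrC.
  rewrite -ltr_pdivrMr// -[X in X < _]lnK ?posrE ?divr_gt0// ltr_expR.
  by rewrite /q; split=> h; lra.
have [a Aa] := A0; have [b Bb] := B0.
have q0 : 0 < q.
  by have /pdfq h := AB _ _ Aa Bb; apply: le_lt_trans h; exact: sqr_ge0.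
set r := Num.sqrt q.
have r0 : 0 < r by rewrite sqrtr_gt0.
have rq : r ^+ 2 = q by rewrite sqr_sqrtr// ltW.
have nr z : `|z| < r <-> z ^+ 2 < q.
  rewrite -rq -[X in _ <-> X < _]real_normK ?num_real//.
  by rewrite ltr_pXn2r ?nnegrE// ltW.
apply: (@le_trans _ _ (4 * r)%:E).
  apply: lebesgue_measure_add_le => // x y Ax By.
  have /pdfq/nr := AB _ _ Ax By.
  by rewrite normrM [`|2^-1|]ger0_norm; lra.
rewrite (_ : 4 * r = 2 * (r - - r)); last by ring.
rewrite EFinM lee_pmul2l// (_ : [set z | _] = `]-r, r[%classic).
  by rewrite lebesgue_measure_itv/= lte_fin ifT ?EFinB//; lra.
by apply/seteqP; split => z /=; rewrite in_itv/= -ltr_norml;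
  [move/pdfq/nr|move/nr/pdfq].
Qed.

(* Normalize [f] and [g] to have supremum 1. For [0 < t < 1] the midpoints of
   [f > t] and [g > t] lie in a superlevel set of the Gaussian density, which is
   an interval, so the lengths of these sets are controlled by its length alone;
   integrating over [t] gives the bound. *)
Lemma prekopa_gauss {R : realType} (f g : R -> R) :
  measurable_fun [set: R] f -> measurable_fun [set: R] g ->
  (forall x, 0 <= f x) -> (forall x, 0 <= g x) ->
  (forall x y, f x * g y <= normal_pdf 0 1 ((x + y) / 2) ^+ 2) ->
  (\int[lebesgue_measure]_x (f x)%:E * \int[lebesgue_measure]_x (g x)%:E <=
    1)%E.
Proof.
move=> mf mg f0 g0 fg.
have n1 : (1 : R) != 0 by exact: oner_neq0.
(* Vanishing factors are settled first: the normalization divides by the suprema, which must be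
   positive. *)
have [/existsNP[x0 /eqP fx0]|] := pselect (~ forall x, f x = 0); last first.
  move=> /contrapT fE; rewrite (eq_integral (cst 0%E)); last first.
    by move=> x _; rewrite fE.
  by rewrite integral0 mul0e.
have [/existsNP[y0 /eqP gy0]|] := pselect (~ forall x, g x = 0); last first.
  move=> /contrapT gE; rewrite [X in (_ * X)%E](eq_integral (cst 0%E));
    last first.
    by move=> x _; rewrite gE.
  by rewrite integral0 mule0.
have {}fx0 : 0 < f x0 by rewrite lt_neqAle eq_sym fx0 f0.
have {}gy0 : 0 < g y0 by rewrite lt_neqAle eq_sym gy0 g0.
set K : R := normal_peak 1.
have pK z : normal_pdf 0 1 z ^+ 2 <= K ^+ 2.
  by rewrite lerXn2r ?nnegrE ?normal_pdf_ge0 ?normal_peak_ge0 ?normal_pdf_ub.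
have supf : has_sup (range f).
  split; first by exists (f x0), x0.
  by exists (K ^+ 2 / g y0) => _ [x _ <-];
    rewrite ler_pdivlMr// (le_trans (fg _ _)).
have supg : has_sup (range g).
  split; first by exists (g y0), y0.
  exists (K ^+ 2 / f x0) => _ [x _ <-].
  by rewrite ler_pdivlMr// mulrC (le_trans (fg _ _)).
set a := sup (range f); set b := sup (range g).
have fa x : f x <= a by apply: sup_upper_bound => //; exists x.
have gb x : g x <= b by apply: sup_upper_bound => //; exists x.
have a0 : 0 < a by exact: lt_le_trans (fa x0).
have b0 : 0 < b by exact: lt_le_trans (gb y0).
(* Dividing the density by [c] gives the normalized functions the hypothesis
   [f1 x * g1 y <= h ((x + y) / 2) ^+ 2]. *)
set c := Num.sqrt (a * b).
have c0 : 0 < c by rewrite sqrtr_gt0 mulr_gt0.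
have cE : c ^+ 2 = a * b by rewrite sqr_sqrtr// mulr_ge0 ?ltW.
pose f1 x := f x / a; pose g1 x := g x / b; pose h x := normal_pdf 0 1 x / c.
have mf1 : measurable_fun setT f1 by exact: measurable_funM.
have mg1 : measurable_fun setT g1 by exact: measurable_funM.
have mh : measurable_fun setT h.
  by apply: measurable_funM => //; exact: measurable_normal_pdf.
have f10 x : 0 <= f1 x by rewrite divr_ge0 ?(ltW a0).
have g10 x : 0 <= g1 x by rewrite divr_ge0 ?(ltW b0).
have h0 x : 0 <= h x by rewrite divr_ge0 ?normal_pdf_ge0 ?(ltW c0).
pose L (k : R -> R) t : set R := [set x | 0 < t < k x].
have mlev (k : R -> R) t : measurable_fun setT k -> measurable (L k t).
  move=> mk; have -> : L k t = [set x | (cst 0 x : R) < cst t x] `&`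
      [set x | cst t x < k x].
    by apply/seteqP; split => x; rewrite /L/=; [case/andP|case=> -> ->].
  by apply: measurableI; exact: measurable_set_ltr.
have level t : (lebesgue_measure (L f1 t) +
    lebesgue_measure (L g1 t) <=
    2%:E * lebesgue_measure (L h t))%E.
  have [t0|t0] := leP t 0.
    have E (k : R -> R) : L k t = set0.
      by apply/seteqP; split => x //; rewrite /L/= ltNge t0.
    by rewrite !E !measure0 mule0 adde0.
  (* From height 1 on, both sets on the left are empty; below 1 the normalization makes both
     nonempty, as [level_set_le] requires. *)
  have [t1|t1] := leP 1 t.
    have -> : L f1 t = set0.
      apply/seteqP; split => x //; rewrite /L/= => /andP[_];
        rewrite ltNge (le_trans _ t1)//.
      by rewrite ler_pdivrMr// mul1r.
    have -> : L g1 t = set0.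
      apply/seteqP; split => x //; rewrite /L/= => /andP[_];
        rewrite ltNge (le_trans _ t1)//.
      by rewrite ler_pdivrMr// mul1r.
    by rewrite measure0 adde0 mule_ge0.
  have -> : L h t = [set x | t * c < normal_pdf 0 1 x].
    by apply/seteqP; split => x; rewrite /L/= t0 ltr_pdivlMr.
  apply: level_set_le => //; try exact: mlev.
  - have : t * a < a by rewrite gtr_pMl.
    case/(sup_gt (proj1 supf)) => _ [x _ <-] xt.
    by exists x; rewrite /L/= t0 ltr_pdivlMr.
  - have : t * b < b by rewrite gtr_pMl.
    case/(sup_gt (proj1 supg)) => _ [x _ <-] xt.
    by exists x; rewrite /L/= t0 ltr_pdivlMr.
  - exact: mulr_gt0.
  - move=> x y; rewrite /L/= => /andP[_]; rewrite ltr_pdivlMr// => xt.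
    move=> /andP[_]; rewrite ltr_pdivlMr// => yt.
    rewrite -(ltr_pXn2r (n := 2))// ?nnegrE ?normal_pdf_ge0 ?mulr_ge0 ?(ltW t0)
      ?(ltW c0)//.
    apply: lt_le_trans (fg x y).
    rewrite exprMn cE (_ : t ^+ 2 * _ = (t * a) * (t * b)); last by ring.
    by apply: ltr_pM => //; rewrite mulr_ge0 ?ltW.
have lc (k : R -> R) : measurable_fun setT k -> (forall x, 0 <= k x) ->
    (\int[lebesgue_measure]_x (k x)%:E = \int[lebesgue_measure]_t
     lebesgue_measure (L k t))%E by exact: layer_cake.
have mL (k : R -> R) : measurable_fun setT k ->
  measurable_fun setT (fun t =>
    lebesgue_measure (L k t)) by exact: measurable_layer.
have le2 : (\int[lebesgue_measure]_x (f1 x)%:E + \int[lebesgue_measure]_x (g1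
  x)%:E
    <= (2 / c)%:E)%E.
  rewrite !lc// -ge0_integralD//; try exact: mL.
  apply: (@le_trans _ _ (\int[lebesgue_measure]_t
      (2%:E * lebesgue_measure (L h t))))%E.
    apply: ge0_le_integral => //.
    - by move=> t _; rewrite adde_ge0.
    - by apply: emeasurable_funD; exact: mL.
    - by apply: emeasurable_funM => //; exact: mL.
  rewrite ge0_integralZl//; last exact: mL.
  rewrite -lc// /h.
  under eq_integral do rewrite mulrC EFinM.
  rewrite ge0_integralZl//.
  - by rewrite integral_normal_pdf mule1 -EFinM.
  - by apply/measurable_EFinP; exact: measurable_normal_pdf.
  - by move=> x _; rewrite lee_fin normal_pdf_ge0.
  - by rewrite lee_fin invr_ge0 ltW.
have scale (k : R -> R) (e : R) : measurable_fun setT k -> (forall x,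
  0 <= k x) -> 0 < e ->
    (\int[lebesgue_measure]_x (k x)%:E = e%:E * \int[lebesgue_measure]_x (k x /
      e)%:E)%E.
  move=> mk k0 e0; rewrite -ge0_integralZl//.
  - by apply: eq_integral => x _; rewrite -EFinM mulrC divfK// gt_eqF.
  - by apply/measurable_EFinP; exact: measurable_funM.
  - by move=> x _; rewrite lee_fin divr_ge0// ltW.
  - by rewrite lee_fin ltW.
(* Arithmetic-geometric mean: [p * q <= ((p + q) / 2) ^+ 2 <= 1 / c ^+ 2], and [a * b = c ^+ 2]
   undoes the normalization. *)
have fin (p q : \bar R) : (0 <= p)%E -> (0 <= q)%E -> (p + q <= (2 / c)%:E)%E ->
    (a%:E * p * (b%:E * q) <= 1)%E; last first.
  rewrite (scale f a)// (scale g b)//; apply: fin le2.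
  - by apply: integral_ge0 => x _; rewrite lee_fin f10.
  - by apply: integral_ge0 => x _; rewrite lee_fin g10.
case: p q => [p||] [q||]//; rewrite !lee_fin => p0 q0 pq.
rewrite (_ : a * p * (b * q) = (p * q) * c ^+ 2); last by rewrite cE; ring.
rewrite -ler_pdivlMr ?exprn_gt0// div1r.
have : ((p + q) * c) ^+ 2 <= 2 ^+ 2.
  by rewrite lerXn2r ?nnegrE ?mulr_ge0 ?addr_ge0 ?(ltW c0)// -ler_pdivlMr.
rewrite exprMn -ler_pdivlMr ?exprn_gt0//.
have := sqr_ge0 (p - q); rewrite !sqrrB !sqrrD.
set z := (c ^+ 2)^-1; lra.
Qed.

(* Maurey's property (tau) for the cost [c]. The test functions take the value
   [+oo] so that the partial integrals of the tensorization are again test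
   functions. *)
Definition property_tau {d} {T : measurableType d} {R : realType}
    (mu : {measure set T -> \bar R}) (c : T -> T -> R) : Prop :=
  forall u v : T -> \bar R,
    measurable_fun [set: T] u -> measurable_fun [set: T] v ->
    (forall x, 0 <= u x)%E -> (forall x, 0 <= v x)%E ->
    (forall x y, u x * v y <= (expR (c x y))%:E)%E ->
  (\int[mu]_x u x * \int[mu]_x v x <= 1)%E.

Lemma fin_num_of_mule_le {R : realType} {T1 T2 : Type} (u : T1 -> \bar R)
    (v : T2 -> \bar R) (c : T1 -> T2 -> R) (y : T2) :
  (forall x, 0 <= u x)%E -> (0 < v y)%E ->
  (forall x y, u x * v y <= (c x y)%:E)%E -> forall x, u x \is a fin_num.
Proof.
move=> u0 vy uv x; have := uv x y; have := u0 x; case: (u x) => [r||]//= _.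
by rewrite gt0_mulye.
Qed.

(** Absorbing the density into [u] and [v] reduces this to [prekopa_gauss], because [x ^+ 2 / 2 + y
    ^+ 2 / 2 - (x - y) ^+ 2 / 4 = (x + y) ^+ 2 / 4]. *)
Lemma normal_prob_property_tau {R : realType} :
  property_tau (normal_prob (0 : R) 1) (fun x y => (x - y) ^+ 2 / 4).
Proof.
move=> u v mu mv u0 v0 uv.
have [/existsNP[x0 /eqP ux0]|] := pselect (~ forall x, u x = 0%E); last first.
  move=> /contrapT uE; rewrite (eq_integral (cst 0%E)); last first.
    by move=> x _; rewrite uE.
  by rewrite integral0 mul0e.
have [/existsNP[y0 /eqP vy0]|] := pselect (~ forall x, v x = 0%E); last first.
  move=> /contrapT vE; rewrite [X in (_ * X)%E](eq_integral (cst 0%E));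
    last first.
    by move=> x _; rewrite vE.
  by rewrite integral0 mule0.
have {}ux0 : (0 < u x0)%E by rewrite lt_neqAle eq_sym ux0 u0.
have {}vy0 : (0 < v y0)%E by rewrite lt_neqAle eq_sym vy0 v0.
(* Once neither function vanishes identically, the product bound excludes infinite values, so
   real-valued functions can replace them. *)
have ufin := fin_num_of_mule_le u0 vy0 uv.
have vfin x : v x \is a fin_num.
  apply: (fin_num_of_mule_le (v := u) (c := fun x y =>
    expR ((y - x) ^+ 2 / 4)) v0 ux0).
  by move=> y z; rewrite muleC.
pose f x := fine (u x) * normal_pdf 0 1 x.
pose g x := fine (v x) * normal_pdf 0 1 x.
rewrite !ge0_integral_normal_prob//.
rewrite (eq_integral (fun x => (f x)%:E)); last first.
  by move=> x _; rewrite EFinM fineK.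
rewrite [X in (_ * X)%E](eq_integral (fun x => (g x)%:E)); last first.
  by move=> x _; rewrite EFinM fineK.
have mpdf := measurable_normal_pdf (0 : R) 1.
apply: prekopa_gauss.
- by apply: measurable_funM => //; exact: measurableT_comp.
- by apply: measurable_funM => //; exact: measurableT_comp.
- by move=> x; rewrite mulr_ge0 ?normal_pdf_ge0 ?fine_ge0.
- by move=> x; rewrite mulr_ge0 ?normal_pdf_ge0 ?fine_ge0.
move=> x y; have := uv x y; rewrite -(fineK (ufin x)) -(fineK (vfin y)).
rewrite -EFinM lee_fin /f /g => le_uv.
rewrite normal_pdfE ?oner_eq0// /normal_fun !subr0 expr1n.
set K := normal_peak 1.
rewrite [X in X <= _](_ : _ = fine (u x) * fine (v y) *
  (K ^+ 2 * expR (- x ^+ 2 / (1 *+ 2) + - y ^+ 2 / (1 *+ 2))));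
    last by rewrite expRD; ring.
apply: (le_trans (ler_wpM2r _ le_uv));
  first by rewrite mulr_ge0 ?sqr_ge0 ?expR_ge0.
rewrite exprMn mulrCA ler_wpM2l ?sqr_ge0// -expRD [X in _ <= X]expr2 -expRD
  ler_expR.
by rewrite le_eqVlt; apply/orP; left; apply/eqP; field.
Qed.

(** For fixed second coordinates [y] and [z], the property of the first factor bounds the product of
    the partial integrals by [expR (c2 y z)]; these integrals are then test functions for the second
    factor. *)
Lemma property_tau_prod {d1 d2} {T1 : measurableType d1}
    {T2 : measurableType d2} {R : realType} (m1 : probability T1 R)
    (m2 : probability T2 R) (c1 : T1 -> T1 -> R) (c2 : T2 -> T2 -> R) :
  property_tau m1 c1 -> property_tau m2 c2 ->
  property_tau (m1 \x m2)%E (fun p q => c1 p.1 q.1 + c2 p.2 q.2).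
Proof.
move=> t1 t2 u v mu mv u0 v0 uv.
rewrite !fubini_tonelli2//.
apply: t2.
- exact: measurable_fun_fubini_tonelli_G.
- exact: measurable_fun_fubini_tonelli_G.
- by move=> y; exact: integral_ge0.
- by move=> y; exact: integral_ge0.
move=> y z; rewrite /fubini_G.
set U := integral _ _ _; set V := integral _ _ _.
have muy : measurable_fun setT (fun x => u (x, y)).
  by apply: measurableT_comp => //; exact: pair2_measurable.
have mvz : measurable_fun setT (fun x => v (x, z)).
  by apply: measurableT_comp => //; exact: pair2_measurable.
have e0 : (0 <= (expR (- c2 y z))%:E)%E by rewrite lee_fin expR_ge0.
(* The weight [expR (- c2 y z)], constant in [x], cancels the second cost. *)
have := t1 (fun x => (expR (- c2 y z))%:E * u (x, y))%E (fun x => v (x, z)).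
rewrite ge0_integralZl// -/U -/V => h.
have {h} : ((expR (- c2 y z))%:E * U * V <= 1)%E.
  apply: h => //.
  - exact: emeasurable_funM.
  - by move=> x; rewrite mule_ge0.
  - move=> x x'; rewrite -muleA.
    apply: (le_trans (lee_wpmul2l e0 (uv (x, y) (x', z)))).
    by rewrite -EFinM -expRD lee_fin ler_expR /=; lra.
rewrite -muleA -lee_pdivlMl ?expR_gt0//.
by rewrite mule1 -expRN opprK.
Qed.

(** * Boxes and the law of a Gaussian vector *)

Definition box {R : realType} {n : nat} (A : 'I_n -> set R) : set (n.-tuple R)
  :=
  [set t | forall i, A i (tnth t i)].

Lemma measurable_tuple_boxE {R : realType} {n : nat} :
  @measurable _ (n.-tuple R) =
  <<s [set B | exists2 A : 'I_n -> set R, (forall i,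
    measurable (A i)) & B = box A] >>.
Proof.
apply/seteqP; split.
- apply: smallest_sub; first exact: smallest_sigma_algebra.
  move=> B; rewrite -bigcup_seq/= => -[i _ [C mC <-]].
  apply: sub_sigma_algebra; exists (fun j => if j == i then C else setT).
    by move=> j; case: ifP.
  apply/seteqP; split => t /=.
    by move=> [_ Ct] j; case: eqP => // ->.
  by move=> /(_ i); rewrite eqxx.
- apply: smallest_sub; first exact: sigma_algebra_measurable.
  move=> _ [A mA ->].
  have -> : box A = \bigcap_(i in [set: 'I_n]) ((@tnth n R)^~ i @^-1` A i).
    by apply/seteqP; split => t /= h i; [move=> _|]; exact: h.
  apply: fin_bigcap_measurable; first exact: finite_finset.
  move=> i _; rewrite -[X in measurable X]setTI.
  exact: measurable_tnth.
Qed.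

(** Boxes are stable under intersection and generate the sigma-algebra, so a finite measure is
    determined by its values on them. *)
Lemma eq_measure_box {R : realType} {n : nat}
    (m1 m2 : {measure set (n.-tuple R) -> \bar R}) :
  (m1 setT < +oo)%E ->
  (forall A : 'I_n -> set R, (forall i,
    measurable (A i)) -> m1 (box A) = m2 (box A)) ->
  forall B, measurable B -> m1 B = m2 B.
Proof.
move=> m1fin m12 B mB.
apply: (measure_unique _ (fun=> setT) measurable_tuple_boxE) => //.
- move=> _ _ [A1 mA1 ->] [A2 mA2 ->]; exists (fun i => A1 i `&` A2 i).
    by move=> i; exact: measurableI.
  apply/seteqP; split => t /=; first by move=> [h1 h2] i; split.
  by move=> h; split => i; have [] := h i.
- by move=> _; exists (fun=> setT) => //; apply/seteqP; split.
- by apply/seteqP; split => // t _; exists 0%N.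
- by move=> _ [A mA ->]; exact: m12.
Qed.

Section gaussian_vector.
Context {d} {T : measurableType d} {R : realType} {P : probability T R}.

Lemma measurable_tuple_of {n : nat} (X : 'I_n -> {RV P >-> R}) :
  measurable_fun [set: T] (fun w => [tuple X i w | i < n]).
Proof.
apply/measurable_fun_tnthP => i.
rewrite (_ : _ \o _ = X i)//.
by apply/funext => w /=; rewrite tnth_mktuple.
Qed.

Lemma independent_lift {n : nat} (X : 'I_n.+1 -> {RV P >-> R}) :
  mutually_independent X -> mutually_independent (fun i => X (lift ord0 i)).
Proof.
move=> indX J A mA.
have injl : injective (lift ord0 : 'I_n -> 'I_n.+1) by exact: lift_inj.
pose A' (j : 'I_n.+1) : set R := if unlift ord0 j is Some i then A i else setT.
have A'E i : A' (lift ord0 i) = A i by rewrite /A' liftK.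
have := indX [set lift ord0 i | i in J]%SET A'.
rewrite big_imset//=; last by move=> ? ? _ _; exact: injl.
under eq_bigr do rewrite A'E.
move=> <-; last by move=> _ /imsetP[i iJ ->]; rewrite A'E; exact: mA.
congr (P _); apply/seteqP; split => w /= h.
- by move=> _ /imsetP[i iJ ->]; rewrite A'E; exact: h.
- by move=> i iJ; rewrite -A'E; apply: h; apply/imsetP; exists i.
Qed.

Lemma distribution_tuple_box {n : nat} (X : 'I_n -> {RV P >-> R}) :
  mutually_independent X -> forall A : 'I_n -> set R, (forall i,
    measurable (A i)) ->
  P ((fun w => [tuple X i w | i < n]) @^-1` box A) =
  (\prod_(i < n) distribution P (X i) (A i))%E.
Proof.
move=> indX A mA; have := indX [set: 'I_n]%SET A (fun i _ => mA i).
rewrite (eq_bigl xpredT); last by move=> i; rewrite inE.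
move=> <-; congr (P _); apply/seteqP; split => w /= h i.
- by move=> _; have := h i; rewrite tnth_mktuple.
- by rewrite tnth_mktuple; apply: h; rewrite inE.
Qed.

(** Induction on the dimension: by independence, the law of the vector is the image under [cns] of
    the product of the normal law and the law of the tail, as is checked on boxes. *)
Lemma gaussian_vector_tau {n : nat} (X : 'I_n -> {RV P >-> R}) :
  (forall i, standard_gaussian (X i)) -> mutually_independent X ->
  forall u v : n.-tuple R -> \bar R,
    measurable_fun [set: n.-tuple R] u -> measurable_fun [set: n.-tuple R] v ->
    (forall x, 0 <= u x)%E -> (forall x, 0 <= v x)%E ->
    (forall x y, u x * v y <= (expR (\sum_i (tnth x i - tnth y i) ^+ 2 /
      4))%:E)%E ->
  (\int[P]_w u [tuple X i w | i < n] * \int[P]_w v [tuple X i w | i < n] <=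
    1)%E.
Proof.
elim: n X => [|n IH] X gX iX u v mu mv u0 v0 uv.
  have E (k : 0.-tuple R -> \bar R) : (forall x, 0 <= k x)%E ->
    (\int[P]_w k [tuple X i w | i < 0] = k [tuple])%E.
    move=> k0; rewrite (eq_integral (cst (k [tuple]))).
      rewrite integral_cst// -[RHS]mule1; congr (_ * _)%E.
      exact: probability_setT.
    by move=> w _; congr k; exact: tuple0.
  rewrite !E//; apply: le_trans (uv _ _) _.
  by rewrite big_ord0 expR0.
pose Y := fun i => X (lift ord0 i).
pose Yt w := [tuple Y i w | i < n].
have mY : measurable_fun setT Yt by exact: measurable_tuple_of.
pose YRV : {RV P >-> n.-tuple R} := HB.pack Yt (isMeasurableFun.Build _ _ _ _ _
  mY).
pose cns (p : R * n.-tuple R) : n.+1.-tuple R := [tuple of p.1 :: p.2].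
have mcns : measurable_fun setT cns by exact: measurable_cons.
pose Z w := [tuple X i w | i < n.+1].
have mZ : measurable_fun setT Z by exact: measurable_tuple_of.
pose ZRV : {RV P >-> n.+1.-tuple R} := HB.pack Z (isMeasurableFun.Build _ _ _ _
  _ mZ).
pose m := (normal_prob (0:R) 1 \x distribution P YRV)%E.
have tauY : property_tau (distribution P YRV)
    (fun x y => \sum_i (tnth x i - tnth y i) ^+ 2 / 4).
  move=> u' v' mu' mv' u'0 v'0 uv'.
  rewrite !ge0_integral_distribution//.
  by apply: IH => //; [move=> i; exact: gX | exact: independent_lift].
have tauZ := property_tau_prod normal_prob_property_tau tauY.
have lawE B : measurable B -> distribution P ZRV B = pushforward m cns B.
  apply: eq_measure_box => //.
    by rewrite (le_lt_trans (probability_le1 _ _))// ltry.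
  move=> A mA; rewrite /pushforward [LHS]distribution_tuple_box//.
  transitivity (m (A ord0 `*` box (fun i => A (lift ord0 i)))); last first.
    congr (m _); apply/seteqP; split => -[a t] /= h.
      by move=> i; case: (unliftP ord0 i) => [j|] ->; [rewrite tnthS;
        apply: h.2|exact: h.1].
    split; first exact: (h ord0).
    by move=> i; have := h (lift ord0 i); rewrite tnthS.
  have mbox : measurable (box (fun i => A (lift ord0 i))).
    by rewrite measurable_tuple_boxE; apply: sub_sigma_algebra;
      exists (fun i => A (lift ord0 i)).
  apply: etrans _ (esym (@product_measure1E _ _ _ _ _ (normal_prob (0 : R) 1)
    (distribution P YRV) _ _ (mA ord0) mbox)).
  rewrite big_ord_recl; congr (_ * _)%E; first exact: gX.
  by rewrite [RHS]distribution_tuple_box//; exact: independent_lift.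
have intE (k : n.+1.-tuple R -> \bar R) : measurable_fun setT k -> (forall x,
  0 <= k x)%E ->
    (\int[P]_w k (Z w) = \int[m]_p k (cns p))%E.
  move=> mk k0; rewrite -(ge0_integral_distribution ZRV)//.
  rewrite (eq_measure_integral (pushforward m cns)).
    by rewrite ge0_integral_pushforward.
  by move=> B mB _; exact: lawE.
rewrite !intE//; apply: tauZ => //.
- exact: measurableT_comp.
- exact: measurableT_comp.
- move=> p q; apply: (le_trans (uv _ _)); rewrite lee_fin ler_expR big_ord_recl.
  by under eq_bigr do rewrite !tnthS.
Qed.

End gaussian_vector.

(** * Measurability and positivity criteria *)

(** [T] carries no topology, so upper semicontinuity of [h] is expressed through the coordinates
    [c]. The set where [h < a] is then the union of the countably many rational boxes that it
    contains. *)
Lemma measurable_fun_coord_semicontinuous {d} {T : measurableType d}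
    {R : realType} {n : nat} (c : 'I_n -> T -> R) (h : T -> R) :
  (forall i, measurable_fun [set: T] (c i)) ->
  (forall w e, 0 < e -> exists2 de, 0 < de &
     forall w', (forall i, `|c i w - c i w'| < de) -> h w' < h w + e) ->
  measurable_fun [set: T] h.
Proof.
move=> mc hc; apply: (measurability _ (RGenInftyO.measurableE R)).
move=> _ [_ [a ->]] <-; rewrite setTI.
pose box (k : nat * {ffun 'I_n -> rat}) : set T :=
  [set w | forall i, `|c i w - ratr (k.2 i)| < k.1.+1%:R^-1].
pose S (k : nat * {ffun 'I_n -> rat}) : set T :=
  if `[< forall w, box k w -> h w < a >] then box k else set0.
have -> : h @^-1` `]-oo, a[%classic = \bigcup_k S k.
  apply/seteqP; split => w /=; rewrite ?in_itv/=; last first.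
    by move=> [k _]; rewrite /S; case: asboolP => // + kw; apply.
  move=> hwa; have [|de de0 hde] := hc w (a - h w); first by rewrite subr_gt0.
  (* Two points of the same box differ by less than [2 / m.+1] in each coordinate, hence
     [de / 2]. *)
  have [m hm] := ltr_add_invr (y := 0) (x := de / 2) ltac:(lra).
  have qex i : exists q : rat, `|c i w - ratr q| < m.+1%:R^-1.
    have : c i w - m.+1%:R^-1 < c i w + m.+1%:R^-1.
      by rewrite ltrBlDr -addrA ltrDl addr_gt0 ?invr_gt0.
    case/rat_in_itvoo => q; rewrite in_itv/= => /andP[q1 q2]; exists q.
    by rewrite ltr_norml; move: q1 q2; set e := _^-1; set z := ratr q => *; lra.
  pose q : {ffun 'I_n -> rat} := [ffun i => projT1 (cid (qex i))].
  have qE i : `|c i w - ratr (q i)| < m.+1%:R^-1.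
    by rewrite ffunE; case: cid.
  exists (m, q) => //; rewrite /S; case: asboolP => // -[] w' w'q.
  rewrite -(subrK (h w) a) addrC; apply: hde => i.
  rewrite (_ : _ - _ = (c i w - ratr (q i)) - (c i w' - ratr (q i)));
    last by ring.
  apply: (le_lt_trans (ler_normB _ _)).
  by have := qE i; have := w'q i; move: hm; rewrite /= add0r;
    set e := _^-1 => *; lra.
apply: countable_bigcupT_measurable => // k; rewrite /S; case: ifP => // _.
have -> : box k = \bigcap_(i in [set: 'I_n]) [set w | `|c i w - ratr (k.2 i)| <
  cst (k.1.+1%:R^-1) w].
  by apply/seteqP; split => w /= h' i; [move=> _|]; exact: h'.
apply: fin_bigcap_measurable; first exact: finite_finset.
move=> i _; apply: measurable_set_ltr => //.
by apply: measurableT_comp => //; exact: measurable_funB.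
Qed.

Lemma integral_pos_gt0 {d} {T : measurableType d} {R : realType}
    (P : probability T R) (f : T -> R) : measurable_fun setT f ->
  (forall w, 0 < f w) -> (0 < \int[P]_w (f w)%:E)%E.
Proof.
move=> mf f0; rewrite lt_neqAle eq_sym integral_ge0 ?andbT; last first.
  by move=> w _; rewrite lee_fin ltW.
apply/eqP => h0.
have : (\int[P]_w `|(f w)%:E| = 0)%E.
  by rewrite -[RHS]h0; apply: eq_integral => w _;
    rewrite gee0_abs// lee_fin ltW.
case/(ae_eq_integral_abs _ measurableT); first exact/measurable_EFinP.
move=> N [mN N0 subN].
have : P [set: T] = 1%E by exact: probability_setT.
suff -> : [set: T] = N by rewrite N0 => /eqP; rewrite lt_eqF.
apply/seteqP; split => // w _; apply: subN => /= /(_ I) [] fw.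
by have := f0 w; rewrite fw ltxx.
Qed.

(** * Gaussian concentration *)

Section exponential_moments.
Context {d} {T : measurableType d} {R : realType} {P : probability T R}.
Variables (Y : {RV P >-> R}) (K : R).
Hypothesis expY : forall s, (\int[P]_w (expR (s * Y w))%:E *
  \int[P]_w (expR (- (s * Y w)))%:E <= (expR (s ^+ 2 * K))%:E)%E.

(** At [s = 1] a product of two positive moments is finite, so each of them is, and
    [expR Y + expR (- Y)] dominates the modulus of [Y]. *)
Lemma integrable_of_exp_moments : P.-integrable setT (EFin \o Y).
Proof.
have := expY 1; under eq_integral do rewrite mul1r.
under [X in (_ * X <= _)%E -> _]eq_integral do rewrite mul1r.
have p1 : (0 < \int[P]_w (expR (Y w))%:E)%E.
  by apply: integral_pos_gt0 => [|w]; [exact: measurableT_comp|exact: expR_gt0].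
have p2 : (0 < \int[P]_w (expR (- Y w))%:E)%E.
  apply: integral_pos_gt0 => [|w]; last exact: expR_gt0.
  by apply: measurableT_comp => //; exact: measurableT_comp.
move=> le12.
have finl (p q : \bar R) r : (0 < p -> 0 < q -> p * q <= r%:E -> p < +oo)%E.
  by case: p => [p||]//; rewrite ?ltry// => _ q0; rewrite gt0_mulye.
apply: (@le_integrable _ _ _ _ _ measurableT _
  (fun w => (expR (Y w))%:E + (expR (- Y w))%:E)%E).
- exact/measurable_EFinP.
- move=> w _ /=; rewrite lee_fin [leRHS]ger0_norm ?addr_ge0 ?expR_ge0//
  ler_norml.
  have := expR_ge1Dx (Y w); have := expR_ge1Dx (- Y w).
  have := expR_ge0 (Y w); have := expR_ge0 (- Y w); lra.
- have fin (f : T -> R) : measurable_fun setT f -> (forall w, 0 <= f w) ->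
    (\int[P]_w (f w)%:E < +oo)%E -> P.-integrable setT (EFin \o f).
    move=> mf f0 foo; apply/integrableP; split; first exact/measurable_EFinP.
    by under eq_integral do rewrite /= ger0_norm//.
  apply: integrableD => //; apply: fin.
  + exact: measurableT_comp.
  + by move=> w; exact: expR_ge0.
  + exact: finl p1 p2 le12.
  + by apply: measurableT_comp => //; exact: measurableT_comp.
  + by move=> w; exact: expR_ge0.
  + by move: le12; rewrite muleC => le21; exact: finl p2 p1 le21.
Qed.

(** Jensen's inequality, obtained from a tangent line of the exponential, bounds the second factor
    of [expY] below by [expR (- (s * m))]. Hence [expR (s * (Y - m))] has mean at most
    [expR (s ^+ 2 * K)], and Chernoff's bound applies. *)
Lemma exp_moments_tail (t : R) : 0 < t -> 0 < K ->
  (P [set w | (fine ('E_P[Y])%E + t <= Y w)%R] <= (expR (- (t ^+ 2 / (4 *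
    K))))%:E)%E.
Proof.
move=> t0 K0.
(* This [s] minimizes [s ^+ 2 * K - s * t], with minimum [- (t ^+ 2 / (4 * K))]. *)
set m := fine ('E_P[Y])%E; pose s := t / (2 * K).
have s0 : 0 < s by rewrite divr_gt0 ?mulr_gt0.
have iY := integrable_of_exp_moments.
have mE : (\int[P]_w (Y w)%:E = m%:E)%E.
  by rewrite /m expectation_def fineK// integrable_fin_num.
apply: (le_trans (chernoff _ _ s0)).
rewrite /mmt_gen_fun unlock.
set A := (\int[P]_w _)%E.
have A0 : (0 <= A)%E by apply: integral_ge0 => w _; rewrite lee_fin expR_ge0.
have AE : (\int[P]_w (expR (s * Y w))%:E = A)%E.
  by apply: eq_integral => w _ /=; rewrite mulrC.
have := expY s; rewrite AE; set B := (\int[P]_w _)%E => AB.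
have B1 : ((expR (- (s * m)))%:E <= B)%E.
  have [Boo|Boo] := eqVneq B +oo%E; first by rewrite Boo leey.
  have iB : P.-integrable setT (EFin \o (fun w => expR (- (s * Y w)))).
    apply/integrableP; split.
      apply/measurable_EFinP; apply: measurableT_comp => //.
      by apply: measurableT_comp => //; exact: measurable_funM.
    under eq_integral do rewrite /= ger0_norm ?expR_ge0//.
    by rewrite ltey.
  set e := expR (- (s * m)).
  have isY : P.-integrable setT (fun w => (e * s)%:E * (Y w)%:E)%E.
    exact: integrableZl.
  have icst : P.-integrable setT (cst (e * (1 + s * m))%:E).
    exact: finite_measure_integrable_cst.
  have -> : (e%:E = \int[P]_w (cst (e * (1 + s * m))%:E w - (e * s)%:E * (Y
    w)%:E))%E.
    rewrite integralB// (_ : \int[P]_w _ = (e * (1 + s * m))%:E)%E; last first.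
      rewrite integral_cst// -[RHS]mule1; congr (_ * _)%E.
      exact: probability_setT.
    rewrite integralZl// mE; apply: (congr1 EFin (_ : e = _ - (e * s) * m)).
    by ring.
  apply: le_integral => //; first exact: integrableB.
  move=> w _.
  change ((e * (1 + s * m) - e * s * Y w)%:E <= (expR (- (s * Y w)))%:E)%E.
  rewrite lee_fin.
  rewrite (_ : - (s * Y w) = - (s * m) + s * (m - Y w)); last by ring.
  rewrite expRD -/e (_ : _ - _ = e * (1 + s * (m - Y w))); last by ring.
  by rewrite ler_wpM2l ?expR_ge0// expR_ge1Dx.
have : (A * (expR (- (s * m)))%:E <= (expR (s ^+ 2 * K))%:E)%E.
  by apply: le_trans AB; exact: lee_wpmul2l.
rewrite muleC -lee_pdivlMl ?expR_gt0// -expRN opprK -EFinM -expRD => h.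
rewrite muleC; apply: (le_trans (lee_wpmul2l _ h));
  first by rewrite lee_fin expR_ge0.
rewrite -EFinM -expRD lee_fin ler_expR /s le_eqVlt; apply/orP; left; apply/eqP.
by field; rewrite gt_eqF.
Qed.

End exponential_moments.

(** * Inner product and empirical norm *)

Section dot_theory.
Context {R : realType} {n : nat}.
Implicit Types u v w : 'cV[R]_n.

Lemma dotC u v : dot u v = dot v u.
Proof. by apply: eq_bigr => i _; rewrite mulrC. Qed.

Lemma dotDl u v w : dot (u + v) w = dot u w + dot v w.
Proof. by rewrite -big_split; apply: eq_bigr => i _; rewrite mxE mulrDl. Qed.

Lemma dotZl a u v : dot (a *: u) v = a * dot u v.
Proof. by rewrite mulr_sumr; apply: eq_bigr => i _; rewrite mxE mulrA. Qed.

Lemma dotNl u v : dot (- u) v = - dot u v.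
Proof. by rewrite -scaleN1r dotZl mulN1r. Qed.

Lemma dotDr u v w : dot u (v + w) = dot u v + dot u w.
Proof. by rewrite !(dotC u) dotDl. Qed.

Lemma dotZr a u v : dot u (a *: v) = a * dot u v.
Proof. by rewrite !(dotC u) dotZl. Qed.

Lemma dotNr u v : dot u (- v) = - dot u v.
Proof. by rewrite !(dotC u) dotNl. Qed.

Definition dotE := (dotDl, dotDr, dotZl, dotZr, dotNl, dotNr).

Lemma dot_ge0 u : 0 <= dot u u.
Proof. by apply: sumr_ge0 => i _; rewrite -expr2 sqr_ge0. Qed.

Lemma cauchy_schwarz u v : dot u v ^+ 2 <= dot u u * dot v v.
Proof.
have [v0|v0] := eqVneq (dot v v) 0.
  have vE i : v i 0 = 0.
    have : dot v v == 0 by rewrite v0.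
    rewrite psumr_eq0; last by move=> j _; rewrite -expr2 sqr_ge0.
    by move=> /allP/(_ i); rewrite mem_index_enum -expr2 sqrf_eq0 =>
      /(_ isT)/eqP.
  have -> : dot u v = 0 by apply: big1 => i _; rewrite vE mulr0.
  by rewrite expr0n/= v0 mulr0.
have vp : 0 < dot v v by rewrite lt_neqAle eq_sym v0 dot_ge0.
have := dot_ge0 (u - (dot u v / dot v v) *: v).
rewrite !dotE (dotC v u).
set p := dot u v; set q := dot v v in vp *; set r := dot u u => h.
suff : 0 <= r - p ^+ 2 / q by rewrite subr_ge0 ler_pdivrMr.
apply: le_trans h _; rewrite le_eqVlt; apply/orP; left; apply/eqP.
by field; rewrite gt_eqF.
Qed.

Lemma dot_mix (a b : R) u v w : dot w (a *: u + b *: v) = a * dot w u + b * dot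
  w v.
Proof. by rewrite !dotE. Qed.

Lemma dotBl u v w : dot (u - v) w = dot u w - dot v w.
Proof. by rewrite !dotE. Qed.

Lemma dotBB u v : dot (u - v) (u - v) = dot (v - u) (v - u).
Proof. by rewrite -opprB dotNl dotNr opprK. Qed.

Lemma sqnorm_nB u v :
  sqnorm_n (u - v) = sqnorm_n u - 2 * (dot u v / n%:R) + sqnorm_n v.
Proof. by rewrite /sqnorm_n !dotE (dotC v u); ring. Qed.

(** The negative term is the strong convexity of the squared norm, the source of the gain in the
    Lipschitz constant of width increments. *)
Lemma sqnorm_n_mix (th : R) u v :
  sqnorm_n ((1 - th) *: u + th *: v) =
  (1 - th) * sqnorm_n u + th * sqnorm_n v - th * (1 - th) * sqnorm_n (u - v).
Proof. by rewrite /sqnorm_n !dotE (dotC v u); ring. Qed.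

Lemma sqnorm_n_ge0 u : 0 <= sqnorm_n u.
Proof. by rewrite divr_ge0 ?dot_ge0. Qed.

End dot_theory.

(** Arithmetic-geometric mean in the form [Num.sqrt (K * N) <= K + N / 4]; it turns a Lipschitz
    bound into the quadratic cost of property (tau). *)
Lemma ler_lipschitz_quarter {R : realType} (D K N : R) :
  0 <= K -> 0 <= N -> D ^+ 2 <= K * N -> D - K <= N / 4.
Proof.
move=> K0 N0 DKN; rewrite lerBlDl.
have [D0|D0] := ltP D 0; first by lra.
rewrite -(ler_pXn2r (n := 2)) ?nnegrE//; last by lra.
apply: (le_trans DKN); have := sqr_ge0 (K - N / 4); nra.
Qed.

Section gaussian_concentration.
Context {d} {T : measurableType d} {R : realType} {P : probability T R}.
Context {n : nat} (eps : 'I_n -> {RV P >-> R}).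
Variables (F : 'cV[R]_n -> R) (K : R).
Hypothesis K_gt0 : 0 < K.
Hypothesis F_lip : forall u v, (F u - F v) ^+ 2 <= K * dot (u - v) (u - v).

Lemma measurable_lipschitz_coord {d'} {T' : measurableType d'}
    (c : 'I_n -> T' -> R) : (forall i, measurable_fun [set: T'] (c i)) ->
  measurable_fun [set: T'] (fun w => F (\col_i c i w)).
Proof.
move=> mc; apply: (measurable_fun_coord_semicontinuous mc) => w e e0.
(* The squared change of [F] is at most [K * n%:R * de ^+ 2], which is below [e ^+ 2] since
   [K * n%:R < (1 + K * n%:R) ^+ 2]. *)
pose de := e / (1 + K * n%:R).
have Kn0 : 0 <= K * n%:R by rewrite mulr_ge0// ltW.
have den0 : 0 < 1 + K * n%:R by lra.
exists de; first by rewrite divr_gt0.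
move=> w' hw.
rewrite addrC -ltrBlDr; set D := F _ - F _.
have [D0|D0] := ltP D 0; first exact: lt_trans e0.
rewrite -(ltr_pXn2r (n := 2)) ?nnegrE// ?(ltW e0)//.
apply: (le_lt_trans (F_lip _ _)).
apply: (@le_lt_trans _ _ (K * (n%:R * de ^+ 2))).
  rewrite ler_wpM2l ?(ltW K_gt0)// /dot mulr_natl -[X in _ <= _ *+ X]card_ord
    -sumr_const.
  apply: ler_sum => i _; rewrite !mxE -expr2 -real_normK ?num_real//.
  by rewrite lerXn2r ?nnegrE// ?divr_ge0 ?(ltW e0) ?(ltW den0)// distrC ltW//
    hw.
rewrite mulrA /de expr_div_n mulrCA gtr_pMr ?exprn_gt0// ltr_pdivrMr
  ?exprn_gt0// mul1r.
nra.
Qed.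

Let Y w := F (noise eps w).

Let mY : measurable_fun [set: T] Y.
Proof. by apply: measurable_lipschitz_coord. Qed.

Let YRV : {RV P >-> R} := HB.pack Y (isMeasurableFun.Build _ _ _ _ _ mY).

Hypothesis eps_gauss : forall i, standard_gaussian (eps i).
Hypothesis eps_indep : mutually_independent eps.

(** Property (tau) is applied to [expR (s * F)] and [expR (- s * F - s ^+ 2 * K)]; the term
    [s ^+ 2 * K] is the price of replacing the Lipschitz bound by the quadratic cost. *)
Let expY s : (\int[P]_w (expR (s * YRV w))%:E *
  \int[P]_w (expR (- (s * YRV w)))%:E <= (expR (s ^+ 2 * K))%:E)%E.
Proof.
pose col (t : n.-tuple R) : 'cV[R]_n := \col_i tnth t i.
have mF : measurable_fun setT (fun t => F (col t)).
  by apply: measurable_lipschitz_coord => i; exact: measurable_tnth.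
have mexp a b : measurable_fun setT (fun t => (expR (a * F (col t) + b))%:E).
  apply/measurable_EFinP; apply: measurableT_comp => //.
  by apply: measurable_funD => //; exact: measurable_funM.
have colE w : col [tuple eps i w | i < n] = noise eps w.
  by apply/colP => i; rewrite !mxE tnth_mktuple.
pose u t := (expR (s * F (col t) + 0))%:E.
pose v t := (expR (- s * F (col t) + - (s ^+ 2 * K)))%:E.
have u0 t : (0 <= u t)%E by rewrite lee_fin expR_ge0.
have v0 t : (0 <= v t)%E by rewrite lee_fin expR_ge0.
have uv x y : (u x * v y <= (expR (\sum_i (tnth x i - tnth y i) ^+ 2 /
  4))%:E)%E.
  rewrite -EFinM -expRD lee_fin ler_expR addr0.
  have -> : \sum_i (tnth x i - tnth y i) ^+ 2 / 4 =
      dot (col x - col y) (col x - col y) / 4.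
    by rewrite -mulr_suml; congr (_ / _); apply: eq_bigr => i _;
      rewrite !mxE expr2.
  have : (s * (F (col x) - F (col y))) ^+ 2 <=
      (s ^+ 2 * K) * dot (col x - col y) (col x - col y).
    by rewrite exprMn -mulrA ler_wpM2l ?sqr_ge0.
  move/(ler_lipschitz_quarter _ (dot_ge0 _)).
  by rewrite mulr_ge0 ?sqr_ge0 ?(ltW K_gt0)// => /(_ isT); lra.
have := gaussian_vector_tau eps_gauss eps_indep (mexp _ _) (mexp _ _) u0 v0 uv.
rewrite /u /v.
under eq_integral do rewrite colE addr0.
under [X in (_ * X <= _)%E -> _]eq_integral do rewrite colE expRD EFinM muleC.
rewrite ge0_integralZl//; last first.
  apply/measurable_EFinP; apply: measurableT_comp => //.
  by apply: measurable_funM.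
rewrite muleCA -lee_pdivlMl ?expR_gt0// mule1 -expRN opprK.
by under [X in (_ * X <= _)%E -> _]eq_integral do rewrite mulNr.
Qed.

Lemma integrable_lipschitz_noise :
  P.-integrable setT (EFin \o (fun w => F (noise eps w))).
Proof. exact: (integrable_of_exp_moments (Y := YRV) expY). Qed.

Lemma gaussian_concentration (t : R) : 0 < t ->
  (P [set w | (fine ('E_P[fun w =>
    F (noise eps w)])%E + t <= F (noise eps w))%R]
   <= (expR (- (t ^+ 2 / (4 * K))))%:E)%E.
Proof. by move=> t0; exact: (exp_moments_tail (Y := YRV) expY t0 K_gt0). Qed.

End gaussian_concentration.

(** * Geometry of the penalized problem *)

Definition deviation {R : realType} {X : Type} {n : nat} (xs : 'I_n -> X)
  (f0 f : X -> R) : 'cV[R]_n := at_points xs f - at_points xs f0.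

Section penalized_geometry.
Context {R : realType} {X : Type} {n : nat}.
Variables (I : (X -> R) -> \bar R) (xs : 'I_n -> X) (lambda : R) (f0 : X -> R).
Hypothesis n_ge1 : (1 <= n)%N.
Hypothesis I_seminorm : seminorm_on_domain I.
Implicit Types (f g : X -> R) (r : R) (e : 'cV[R]_n).

Local Notation tau := (tau I xs lambda f0).
Local Notation dom := (finite_penalty I).
Local Notation ball := (tau_ball I xs lambda f0).
Local Notation rmin := (Rmin I xs lambda f0).

Local Notation shift := (deviation xs f0).

Definition mix (th : R) f g : X -> R := fun z => (1 - th) * f z + th * g z.

(* [Mn] as a function of the noise vector [e]. *)
Definition width r e : R := sup [set dot e (shift f) / n%:R | f in ball r].

Let n_gt0 : (0 : R) < n%:R. Proof. by rewrite ltr0n. Qed.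

Lemma tau_ge0 f : 0 <= tau f. Proof. exact: sqrtr_ge0. Qed.

Lemma sqr_tau f : tau f ^+ 2 = sqnorm_n (shift f) + lambda ^+ 2 * fine (I f) ^+
  2.
Proof.
apply: sqr_sqrtr; apply: addr_ge0; first exact: sqnorm_n_ge0.
by rewrite mulr_ge0 ?sqr_ge0.
Qed.

Lemma sqnorm_le_sqr_tau f : sqnorm_n (shift f) <= tau f ^+ 2.
Proof. by rewrite sqr_tau lerDl mulr_ge0 ?sqr_ge0. Qed.

Lemma mix_domain th f g : dom f -> dom g -> dom (mix th f g).
Proof.
by move=> df dg; apply: (domainD I_seminorm); exact: (domainZ I_seminorm).
Qed.

Lemma shift_mix th f g : shift (mix th f g) = (1 - th) *: shift f + th *: shift
  g.
Proof. by apply/colP => i; rewrite !mxE /mix; ring. Qed.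

Let fin_penalty f : dom f -> (fine (I f))%:E = I f.
Proof.
move=> df; rewrite fineK// ge0_fin_numE//; exact: (penalty_ge0 I_seminorm).
Qed.

Lemma penalty_mix th f g : 0 <= th <= 1 -> dom f -> dom g ->
  fine (I (mix th f g)) <= (1 - th) * fine (I f) + th * fine (I g).
Proof.
move=> /andP[th0 th1] df dg; have th1' : 0 <= 1 - th by rewrite subr_ge0.
rewrite -lee_fin fin_penalty; last exact: mix_domain.
apply: (le_trans (penaltyD I_seminorm (domainZ I_seminorm _ df)
  (domainZ I_seminorm _ dg))).
rewrite !(penaltyZ I_seminorm)// !ger0_norm//.
by rewrite -(fin_penalty df) -(fin_penalty dg) -!EFinM -EFinD.
Qed.

Let fine_penalty_ge0 f : 0 <= fine (I f).
Proof. by rewrite fine_ge0// (penalty_ge0 I_seminorm). Qed.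

(** The quadratic gain comes from the norm alone; the squared penalty enters only as a convex
    function. *)
Lemma sqr_tau_mix th f g : 0 <= th <= 1 -> dom f -> dom g ->
  tau (mix th f g) ^+ 2 <= (1 - th) * tau f ^+ 2 + th * tau g ^+ 2
                           - th * (1 - th) * sqnorm_n (shift f - shift g).
Proof.
move=> th01 df dg; have /andP[th0 th1] := th01; rewrite !sqr_tau shift_mix.
rewrite sqnorm_n_mix.
have JJ : fine (I (mix th f g)) ^+ 2 <=
    (1 - th) * fine (I f) ^+ 2 + th * fine (I g) ^+ 2.
  apply: (@le_trans _ _ (((1 - th) * fine (I f) + th * fine (I g)) ^+ 2)).
    rewrite lerXn2r ?nnegrE// ?penalty_mix//.
    by rewrite addr_ge0 ?mulr_ge0 ?subr_ge0.
  have : 0 <= th * (1 - th) * (fine (I f) - fine (I g)) ^+ 2.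
    by rewrite mulr_ge0 ?sqr_ge0 ?mulr_ge0 ?subr_ge0.
  nra.
have := ler_wpM2l (sqr_ge0 lambda) JJ; lra.
Qed.

(** [tau] is the Euclidean norm of the pair formed by the empirical norm of the deviation and
    [lambda] times the penalty, so this is Minkowski's inequality, reduced to a bound on the cross
    term. *)
Lemma tau_mix th f g : 0 <= th <= 1 -> dom f -> dom g ->
  tau (mix th f g) <= (1 - th) * tau f + th * tau g.
Proof.
move=> th01 df dg; have /andP[th0 th1] := th01.
have th1' : 0 <= 1 - th by rewrite subr_ge0.
rewrite -(ler_pXn2r (n := 2)) ?nnegrE ?tau_ge0 ?addr_ge0 ?mulr_ge0 ?tau_ge0//.
rewrite [X in X <= _]sqr_tau shift_mix sqnorm_n_mix sqnorm_nB.
have pm := penalty_mix th01 df dg; move: (fine_penalty_ge0 (mix th f g)) pm.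
have := sqr_tau f; have := sqr_tau g.
have := tau_ge0 f; have := tau_ge0 g; have := fine_penalty_ge0 f;
  have := fine_penalty_ge0 g.
move: (shift f) (shift g) (tau f) (tau g) (fine (I f)) (fine (I g)) (fine (I
  (mix th f g))).
move=> u v a b J J' Jm J'0 J0 b0 a0 bE aE Jm0 JmE.
have JmE2 : Jm ^+ 2 <= ((1 - th) * J + th * J') ^+ 2.
  by rewrite lerXn2r ?nnegrE// (le_trans Jm0).
suff : dot u v / n%:R + lambda ^+ 2 * (J * J') <= a * b.
  move=> h; have := ler_wpM2l (mulr_ge0 th0 th1') h.
  have := ler_wpM2l (sqr_ge0 lambda) JmE2.
  rewrite [X in _ -> _ -> _ <= X]sqrrD !exprMn aE bE; lra.
set A := Num.sqrt (sqnorm_n u); set B := Num.sqrt (sqnorm_n v).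
have A2 : A ^+ 2 = sqnorm_n u by rewrite sqr_sqrtr ?sqnorm_n_ge0.
have B2 : B ^+ 2 = sqnorm_n v by rewrite sqr_sqrtr ?sqnorm_n_ge0.
have uv : dot u v / n%:R <= A * B.
  have [uv0|uv0] := leP (dot u v / n%:R) 0.
    by apply: (le_trans uv0); rewrite mulr_ge0 ?sqrtr_ge0.
  rewrite -(ler_pXn2r (n := 2)) ?nnegrE ?(ltW uv0) ?mulr_ge0 ?sqrtr_ge0//.
  rewrite [X in _ <= X]exprMn A2 B2 /sqnorm_n expr_div_n mulrACA -invfM -expr2.
  by rewrite ler_wpM2r ?cauchy_schwarz// invr_ge0 sqr_ge0.
apply: (@le_trans _ _ (A * B + (lambda ^+ 2 * (J * J')))); first exact: lerD.
rewrite -(ler_pXn2r (n := 2)) ?nnegrE//; first last.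
- exact: mulr_ge0.
- by rewrite addr_ge0 ?(mulr_ge0 (sqrtr_ge0 _)) ?sqrtr_ge0 ?(mulr_ge0 (sqr_ge0
  _)) ?mulr_ge0.
rewrite exprMn aE bE -A2 -B2.
(* By Lagrange's identity, this square is exactly the difference of the two sides. *)
have := sqr_ge0 (lambda * (A * J' - B * J)); lra.
Qed.

Lemma rmin_le f : dom f -> rmin <= tau f.
Proof.
move=> df; apply: ge_inf; last by exists f.
by exists 0 => _ [g _ <-]; exact: tau_ge0.
Qed.

Hypothesis rmin_attained : exists2 f, dom f & tau f = rmin.

Lemma rmin_ge0 : 0 <= rmin.
Proof. by case: rmin_attained => f _ <-; exact: tau_ge0. Qed.

Lemma ball_sqnorm r f : ball r f -> sqnorm_n (shift f) <= r ^+ 2.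
Proof.
move=> [_ fr]; apply: (le_trans (sqnorm_le_sqr_tau f)).
by rewrite lerXn2r ?nnegrE ?tau_ge0// (le_trans (tau_ge0 f)).
Qed.

(** [sup] is meaningful only on nonempty bounded sets. Attainment of the minimum gives a member even
    at [r = rmin]; the upper bound expands [0 <= sqnorm_n (e - shift f)]. *)
Lemma has_sup_width r e : rmin <= r ->
  has_sup [set dot e (shift f) / n%:R | f in ball r].
Proof.
move=> rr; split.
  case: rmin_attained => f df fr.
  by exists (dot e (shift f) / n%:R), f => //; split => //; rewrite fr.
exists ((sqnorm_n e + r ^+ 2) / 2) => _ [f fr <-].
have := ball_sqnorm fr; have := sqnorm_n_ge0 (e - shift f).
rewrite sqnorm_nB; lra.
Qed.

Lemma width_ge r e f : rmin <= r -> ball r f -> dot e (shift f) / n%:R <= width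
  r e.
Proof.
by move=> rr fr; apply: sup_upper_bound; [exact: has_sup_width|exists f].
Qed.

Lemma width_adherent r e (de : R) : rmin <= r -> 0 < de ->
  exists2 f, ball r f & width r e - de < dot e (shift f) / n%:R.
Proof.
move=> rr de0; have [_ [f fr <-] h] := sup_adherent de0 (has_sup_width e rr).
by exists f.
Qed.

(** The mixture of near-optimal functions for [r] and [r'] lies in the ball of mixed radius by
    convexity of [tau], and its pairing with [e] is the mixture of theirs. *)
Lemma width_concave th r r' e : 0 <= th <= 1 -> rmin <= r -> rmin <= r' ->
  (1 - th) * width r e + th * width r' e <= width ((1 - th) * r + th * r') e.
Proof.
move=> th01 rr rr'; have /andP[th0 th1] := th01.
have th1' : 0 <= 1 - th by rewrite subr_ge0.
apply/ler_addgt0Pr => de de0.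
have [f [df fr] hf] := width_adherent e rr de0.
have [g [dg gr] hg] := width_adherent e rr' de0.
have rr3 : rmin <= (1 - th) * r + th * r'.
  have := ler_wpM2l th1' rr; have := ler_wpM2l th0 rr'; lra.
have mb : ball ((1 - th) * r + th * r') (mix th f g).
  split; first exact: mix_domain.
  apply: (le_trans (tau_mix th01 df dg)).
  by rewrite lerD ?ler_wpM2l.
have := width_ge e rr3 mb; rewrite shift_mix dot_mix mulrDl -!mulrA.
have := ler_wpM2l th1' (ltW hf); have := ler_wpM2l th0 (ltW hg); lra.
Qed.

(** A near-optimal function for [e] is also admissible for [e']; its deviation has empirical norm at
    most [r], so Cauchy-Schwarz bounds the loss. *)
Lemma width_lipschitz r : rmin <= r -> forall e e',
  (width r e - width r e') ^+ 2 <= r ^+ 2 / n%:R * dot (e - e') (e - e').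
Proof.
move=> rr.
suff half e e' : width r e - width r e' <= Num.sqrt (r ^+ 2 / n%:R * dot (e -
  e') (e - e')).
  move=> e e'; set N := _ * dot _ _.
  have N0 : 0 <= N by rewrite mulr_ge0 ?dot_ge0 ?divr_ge0 ?sqr_ge0 ?ltW.
  rewrite -[X in _ <= X](sqr_sqrtr N0) -real_normK ?num_real//.
  rewrite lerXn2r ?nnegrE ?sqrtr_ge0// ler_norml half andbT lerNl opprB.
  by rewrite (le_trans (half _ _))// /N dotBB.
rewrite lerBlDr; apply/ler_addgt0Pr => de de0.
have [f fr hf] := width_adherent e rr de0.
have h1 := width_ge e' rr fr.
have : dot (e - e') (shift f) / n%:R <= Num.sqrt (r ^+ 2 / n%:R * dot (e - e')
  (e - e')).
  apply: (le_trans (ler_norm _)); rewrite -sqrtr_sqr ler_wsqrtr//.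
  rewrite expr_div_n; apply: (le_trans (ler_wpM2r _ (cauchy_schwarz _ _))).
    by rewrite invr_ge0 sqr_ge0.
  have := ler_wpM2l (divr_ge0 (dot_ge0 (e - e')) (ltW n_gt0)) (ball_sqnorm fr).
  rewrite /sqnorm_n; set N := dot (e - e') _; set q := dot (shift f) _.
  have -> : N / n%:R * (q / n%:R) = N * q / n%:R ^+ 2 by rewrite expr2 invfM;
    ring.
  lra.
rewrite dotBl mulrBl; lra.
Qed.

(* Let [fb] and [fa] be almost optimal for [(b, e)] and [(a, e')]. If they are
   at squared distance more than [b^2 - a^2], moving each towards the other
   keeps them in their balls, by strong convexity of [tau ^+ 2], and leaves only
   the fraction [mu] of [fb - fa] paired with [e - e']. *)
Lemma width_increment_lipschitz_le a b : rmin <= a -> a <= b -> forall e e',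
  (width b e - width a e) - (width b e' - width a e') <=
  Num.sqrt ((b ^+ 2 - a ^+ 2) / n%:R * dot (e - e') (e - e')).
Proof.
move=> ra ab e e'; have rb := le_trans ra ab.
have a0 := le_trans rmin_ge0 ra; have b0 := le_trans a0 ab.
set N := dot (e - e') (e - e'); set k := b ^+ 2 - a ^+ 2.
have k0 : 0 <= k by rewrite subr_ge0 lerXn2r ?nnegrE.
set S := Num.sqrt _.
apply/ler_addgt0Pr => de de0; have de20 : 0 < de / 2 by rewrite divr_gt0.
have [fb [dfb fbb] hb] := width_adherent e rb de20.
have [fa [dfa faa] ha] := width_adherent e' ra de20.
set D := sqnorm_n (shift fa - shift fb).
have D0 : 0 <= D by exact: sqnorm_n_ge0.
(* [mu = 1] serves when [D <= k], and [mu = k / D] otherwise. The third condition keeps a mixture in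
   the smaller ball; the fourth bounds the Cauchy-Schwarz term. *)
have [mu [mu0 mu1 muk muD]] : exists mu, [/\ 0 <= mu, mu <= 1,
    (1 - mu) * k <= mu * (1 - mu) * D & mu ^+ 2 * D <= k].
  have [Dk|kD] := leP D k.
    by exists 1; split => //; rewrite ?subrr ?mulr0 ?mul0r// expr1n mul1r.
  have Dp : 0 < D by exact: le_lt_trans kD.
  exists (k / D); rewrite divr_ge0// ler_pdivrMr// mul1r (ltW kD); split => //.
    by rewrite le_eqVlt; apply/orP; left; apply/eqP; field; rewrite gt_eqF.
  rewrite (_ : _ * D = k * k / D); last by field; rewrite gt_eqF.
  by rewrite ler_pdivrMr// ler_wpM2l// ltW.
have mu01 : 0 <= mu <= 1 by rewrite mu0.
have mu01' : 0 <= 1 - mu <= 1 by lra.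
have fa2 : tau fa ^+ 2 <= a ^+ 2 by rewrite lerXn2r ?nnegrE ?tau_ge0.
have fb2 : tau fb ^+ 2 <= b ^+ 2 by rewrite lerXn2r ?nnegrE ?tau_ge0.
have mD : 0 <= mu * (1 - mu) * D by rewrite mulr_ge0// mulr_ge0// subr_ge0.
have ga : ball a (mix (1 - mu) fa fb).
  split; first exact: mix_domain.
  rewrite -(ler_pXn2r (n := 2)) ?nnegrE ?tau_ge0//.
  apply: (le_trans (sqr_tau_mix mu01' dfa dfb)); rewrite -/D.
  have := ler_wpM2l mu0 fa2; have : (1 - mu) * tau fb ^+ 2 <= (1 - mu) * b ^+ 2.
    by rewrite ler_wpM2l ?subr_ge0.
  by move: muk; rewrite /k; nra.
have gb : ball b (mix mu fa fb).
  split; first exact: mix_domain.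
  rewrite -(ler_pXn2r (n := 2)) ?nnegrE ?tau_ge0//.
  apply: (le_trans (sqr_tau_mix mu01 dfa dfb)); rewrite -/D.
  have := ler_wpM2l mu0 fb2; have : (1 - mu) * tau fa ^+ 2 <= (1 - mu) * b ^+ 2.
    rewrite ler_wpM2l ?subr_ge0// (le_trans fa2)//.
    by rewrite -subr_ge0.
  nra.
have h1 := width_ge e ra ga; have h2 := width_ge e' rb gb.
have cs : mu * dot (e - e') (shift fb - shift fa) / n%:R <= S.
  apply: (le_trans (ler_norm _)); rewrite -sqrtr_sqr ler_wsqrtr//.
  rewrite expr_div_n exprMn.
  apply: (@le_trans _ _ (mu ^+ 2 * (N * (n%:R * D)) / n%:R ^+ 2)).
    rewrite ler_wpM2r ?invr_ge0 ?sqr_ge0// ler_wpM2l ?sqr_ge0//.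
    apply: (le_trans (cauchy_schwarz _ _)); rewrite ler_wpM2l ?dot_ge0//.
    by rewrite /D /sqnorm_n mulrC mulfVK ?gt_eqF// dotBB.
  have -> : mu ^+ 2 * (N * (n%:R * D)) / n%:R ^+ 2 = (mu ^+ 2 * D) / n%:R * N.
    by field; rewrite gt_eqF.
  by rewrite ler_wpM2r ?dot_ge0// ler_wpM2r// invr_ge0 ltW.
have dotBB' u v : dot (e - e') (v - u) = dot e v - dot e u - (dot e' v - dot e'
  u).
  by rewrite !dotE; ring.
move: h1 h2 cs hb ha; rewrite !shift_mix !dot_mix dotBB'.
set p1 := dot e (shift fa); set p2 := dot e (shift fb).
set p3 := dot e' (shift fa); set p4 := dot e' (shift fb).
set z := n%:R^-1.
nra.
Qed.

Lemma width_increment_lipschitz a b : rmin <= a -> rmin <= b -> forall e e',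
  ((width b e - width a e) - (width b e' - width a e')) ^+ 2 <=
  `|b ^+ 2 - a ^+ 2| / n%:R * dot (e - e') (e - e').
Proof.
wlog ab : a b / a <= b.
  move=> wl ra rb e e'; have [ab|/ltW ba] := leP a b; first exact: wl.
  rewrite distrC; apply: le_trans (wl b a ba rb ra e e').
  by rewrite -sqrrN le_eqVlt; apply/orP; left; apply/eqP; congr (_ ^+ 2); ring.
move=> ra rb.
have k0 : 0 <= b ^+ 2 - a ^+ 2.
  by rewrite subr_ge0 lerXn2r ?nnegrE// (le_trans rmin_ge0).
have half := width_increment_lipschitz_le ra ab.
rewrite ger0_norm// => e e'; set N := _ * dot _ _.
have N0 : 0 <= N by rewrite mulr_ge0 ?dot_ge0// divr_ge0// ltW.
rewrite -[X in _ <= X](sqr_sqrtr N0) -real_normK ?num_real//.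
rewrite lerXn2r ?nnegrE ?sqrtr_ge0// ler_norml half andbT lerNl opprB.
by rewrite (le_trans (half _ _))// /N dotBB.
Qed.

End penalized_geometry.

(** * Quadratic decay at the maximizer and stability of the estimator *)

(** Subtracting [r ^+ 2 / 2] from a concave function makes it strongly concave. Comparing the
    maximum with the value at the fraction [th] of the way from [rs] to [r] gives
    [(1 - th) * D / 2 <= g], and a small [th] suffices. *)
Lemma concave_minus_sqr_gap {R : realType} (m : R -> R) (r0 rs : R) :
  (forall th r r', 0 <= th <= 1 -> r0 <= r -> r0 <= r' ->
     (1 - th) * m r + th * m r' <= m ((1 - th) * r + th * r')) ->
  r0 <= rs ->
  (forall r, r0 <= r -> m r - r ^+ 2 / 2 <= m rs - rs ^+ 2 / 2) ->
  forall r, r0 <= r ->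
    (r - rs) ^+ 2 / 2 <= (m rs - rs ^+ 2 / 2) - (m r - r ^+ 2 / 2).
Proof.
move=> mconc r0s mmax r rr.
set D := (r - rs) ^+ 2; set g := _ - _ - _.
have g0 : 0 <= g by rewrite subr_ge0 mmax.
have conc th : 0 < th -> th <= 1 -> (1 - th) * D / 2 <= g.
  move=> th0 th1; have th01 : 0 <= th <= 1 by rewrite ltW.
  have h1 := mconc th rs r th01 r0s rr.
  have rr' : r0 <= (1 - th) * rs + th * r.
    have : 0 <= (1 - th) * (rs - r0) by rewrite mulr_ge0 ?subr_ge0.
    have : 0 <= th * (r - r0) by rewrite mulr_ge0 ?subr_ge0 ?(ltW th0).
    lra.
  have h2 := mmax _ rr'.
  rewrite -(ler_pM2l th0) /D /g; lra.
rewrite leNgt; apply/negP => gD.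
have D0 : 0 < D by lra.
(* With this [th] the inequality reads [D / 4 + g / 2 <= g], against [g < D / 2]. *)
have := conc ((D / 2 - g) / D); rewrite divr_gt0 ?subr_gt0//.
rewrite ler_pdivrMr// mul1r => /(_ isT) h.
have {h} : (1 - (D / 2 - g) / D) * D / 2 <= g by apply: h; lra.
rewrite mulrBl mul1r mulfVK ?gt_eqF//; lra.
Qed.

Section estimator.
Context {R : realType} {X : Type} {n : nat}.
Variables (I : (X -> R) -> \bar R) (xs : 'I_n -> X) (lambda : R) (f0 : X -> R).
Hypothesis n_ge1 : (1 <= n)%N.
Hypothesis I_seminorm : seminorm_on_domain I.
Hypothesis rmin_attained : exists2 f, finite_penalty I f &
  tau I xs lambda f0 f = Rmin I xs lambda f0.

Local Notation tau := (tau I xs lambda f0).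
Local Notation rmin := (Rmin I xs lambda f0).
Local Notation width := (width I xs lambda f0).

(** Up to a term independent of [f], the loss is [-2] times
    [dot e (shift f) / n%:R - tau f ^+ 2 / 2]. Since [tau f <= r] on the ball of radius [r],
    optimality among functions passes to radii. *)
Lemma argmin_tau_maximizes (e : 'cV[R]_n) fh :
  unique_argmin (finite_penalty I)
    (penalized_loss I xs lambda (at_points xs f0 + e)) fh ->
  forall r, rmin <= r -> width r e - r ^+ 2 / 2 <= width (tau fh) e - tau fh ^+
    2 / 2.
Proof.
move=> [dfh fh_min] r rr.
pose shift := deviation xs f0.
have lossE f : penalized_loss I xs lambda (at_points xs f0 + e) f =
    sqnorm_n e - 2 * (dot e (shift f) / n%:R) + tau f ^+ 2.
  rewrite sqr_tau /penalized_loss.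
  have -> : at_points xs f0 + e - at_points xs f = e - shift f.
    by rewrite /shift /deviation opprB addrA (addrC e).
  by rewrite sqnorm_nB -/(shift f); ring.
have fh_le f : finite_penalty I f ->
    dot e (shift f) / n%:R - tau f ^+ 2 / 2 <=
    dot e (shift fh) / n%:R - tau fh ^+ 2 / 2.
  move=> df; have [->//|ffh] := pselect (f = fh).
  by have := fh_min _ df ffh; rewrite !lossE; lra.
have rfh : rmin <= tau fh by exact: rmin_le.
have hfh : dot e (shift fh) / n%:R <= width (tau fh) e by apply: width_ge.
have [sup0 _] := has_sup_width rmin_attained e rr.
have : width r e <= width (tau fh) e - tau fh ^+ 2 / 2 + r ^+ 2 / 2.
  apply: ge_sup => // _ [f [df fr] <-].
  have := fh_le f df; rewrite -/(shift f).
  have : tau f ^+ 2 <= r ^+ 2.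
    rewrite lerXn2r ?nnegrE ?tau_ge0//.
    exact: le_trans (tau_ge0 I xs lambda f0 f) fr.
  lra.
lra.
Qed.

(** This stability in the noise serves measurability. Adding the quadratic gaps at the two
    maximizers bounds [(tau fh' - tau fh) ^+ 2] by the change of a width increment, which is
    Lipschitz. *)
Lemma tau_argmin_holder e e' fh fh' :
  unique_argmin (finite_penalty I)
    (penalized_loss I xs lambda (at_points xs f0 + e)) fh ->
  unique_argmin (finite_penalty I)
    (penalized_loss I xs lambda (at_points xs f0 + e')) fh' ->
  ((tau fh' - tau fh) ^+ 2) ^+ 2 <=
    `|tau fh' ^+ 2 - tau fh ^+ 2| / n%:R * dot (e - e') (e - e').
Proof.
move=> fmin fmin'.
have rfh : rmin <= tau fh by apply: rmin_le; case: fmin.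
have rfh' : rmin <= tau fh' by apply: rmin_le; case: fmin'.
have conc e1 := fun th r r' => @width_concave _ _ _ I xs lambda f0
  I_seminorm rmin_attained th r r' e1.
have g1 := concave_minus_sqr_gap (conc e) rfh (argmin_tau_maximizes fmin) rfh'.
have g2 := concave_minus_sqr_gap (conc e') rfh' (argmin_tau_maximizes fmin')
  rfh.
apply: le_trans (width_increment_lipschitz n_ge1 I_seminorm rmin_attained rfh
  rfh' e e').
rewrite -[X in _ <= X]sqrrN lerXn2r ?nnegrE ?sqr_ge0//.
  by apply: le_trans (sqr_ge0 (tau fh' - tau fh)) _; move: g1 g2; lra.
by move: g1 g2; lra.
Qed.

End estimator.

(** * Deviation of the estimator *)

Section concentration.
Context {R : realType} {d : measure_display} {T : measurableType d}
  {P : probability T R} {X : Type} {n : nat}.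
Variables (I : (X -> R) -> \bar R) (xs : 'I_n -> X) (lambda : R) (f0 : X -> R).
Variable eps : 'I_n -> {RV P >-> R}.
Hypothesis n_ge1 : (1 <= n)%N.
Hypothesis I_seminorm : seminorm_on_domain I.
Hypothesis rmin_attained : exists2 f, finite_penalty I f &
  tau I xs lambda f0 f = Rmin I xs lambda f0.
Hypothesis eps_gauss : forall i, standard_gaussian (eps i).
Hypothesis eps_indep : mutually_independent eps.

Local Notation tau := (tau I xs lambda f0).
Local Notation rmin := (Rmin I xs lambda f0).
Local Notation width := (width I xs lambda f0).
Local Notation H := (H eps I xs lambda f0).

Let n_gt0 : (0 : R) < n%:R. Proof. by rewrite ltr0n. Qed.

Definition mean_width r := fine (\int[P]_w (width r (noise eps w))%:E)%E.

Lemma integrable_width r : rmin <= r ->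
  P.-integrable setT (fun w => (width r (noise eps w))%:E).
Proof.
move=> rr.
(* The [+ 1] keeps the Lipschitz constant positive at [r = 0]. *)
apply: (@integrable_lipschitz_noise _ _ _ _ _ eps (width r) ((r ^+ 2 + 1) /
  n%:R)) => //.
  by rewrite divr_gt0 // ltr_wpDl ?sqr_ge0.
move=> e e'; apply: (le_trans (width_lipschitz n_ge1 rmin_attained rr e e')).
by rewrite ler_wpM2r ?dot_ge0// ler_wpM2r ?invr_ge0 ?(ltW n_gt0)// lerDl.
Qed.

Lemma mean_widthE r : rmin <= r ->
  (\int[P]_w (width r (noise eps w))%:E = (mean_width r)%:E)%E.
Proof.
by move=> rr; rewrite fineK// integrable_fin_num//; exact: integrable_width.
Qed.

Lemma H_mean_width r : rmin <= r -> H r = (mean_width r - r ^+ 2 / 2)%:E.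
Proof.
move=> rr; rewrite /H unlock.
have icst : P.-integrable setT (cst (r ^+ 2 / 2)%:E).
  exact: finite_measure_integrable_cst.
transitivity (\int[P]_w ((width r (noise eps w))%:E - (cst (r ^+ 2 / 2)%:E)
  w))%E.
  by apply: eq_integral => w _; rewrite /cst -EFinB.
rewrite integralB//; last exact: integrable_width.
rewrite mean_widthE// integral_cst//.
rewrite [X in (_ - X)%E](_ : _ = (r ^+ 2 / 2)%:E) ?EFinB//.
rewrite -[RHS]mule1; congr (_ * _)%E; exact: probability_setT.
Qed.

Lemma mean_width_concave th r r' : 0 <= th <= 1 -> rmin <= r -> rmin <= r' ->
  (1 - th) * mean_width r + th * mean_width r' <=
  mean_width ((1 - th) * r + th * r').
Proof.
move=> th01 rr rr'; have /andP[th0 th1] := th01.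
have th1' : 0 <= 1 - th by rewrite subr_ge0.
have rr3 : rmin <= (1 - th) * r + th * r'.
  have := ler_wpM2l th1' rr; have := ler_wpM2l th0 rr'; lra.
rewrite -lee_fin EFinD !EFinM -!mean_widthE//.
have i1 := integrable_width rr; have i2 := integrable_width rr'.
rewrite -!integralZl//.
have i1' := integrableZl measurableT (1 - th) i1.
have i2' := integrableZl measurableT th i2.
rewrite -integralD//; apply: le_integral => //; first exact: integrableD.
  exact: integrable_width.
move=> w _; rewrite -!EFinM -EFinD lee_fin.
exact: width_concave.
Qed.

Variable R0 : R.
Hypothesis R0_argmax : unique_argmax [set r | rmin <= r] H R0.

Let rminR0 : rmin <= R0. Proof. by case: R0_argmax. Qed.

Lemma mean_width_gap r : rmin <= r ->
  (r - R0) ^+ 2 / 2 <=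
  (mean_width R0 - R0 ^+ 2 / 2) - (mean_width r - r ^+ 2 / 2).
Proof.
apply: (concave_minus_sqr_gap mean_width_concave rminR0) => {}r rr.
have [->//|rR0] := pselect (r = R0).
have [_ /(_ r rr rR0)] := R0_argmax.
by rewrite !H_mean_width// lte_fin => /ltW.
Qed.

(** On [S] the width increment exceeds its mean by at least [t = (r - R0) ^+ 2 / 2], by
    [mean_width_gap]; the exponent is [t ^+ 2 / (4 * K)] for the Lipschitz constant [K] of the
    increment. *)
Lemma width_deviation (S : set T) r : measurable S -> rmin <= r -> r != R0 ->
  (forall w, S w -> width R0 (noise eps w) - R0 ^+ 2 / 2 <=
                    width r (noise eps w) - r ^+ 2 / 2) ->
  (P S <= (expR (- (n%:R * (r - R0) ^+ 4 / (16 * `|r ^+ 2 - R0 ^+ 2|))))%:E)%E.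
Proof.
move=> mS rr rR0 Sr.
have R0ge0 : 0 <= R0 := le_trans (rmin_ge0 rmin_attained) rminR0.
have r_ge0 : 0 <= r := le_trans (rmin_ge0 rmin_attained) rr.
pose F e := width r e - width R0 e.
pose K := `|r ^+ 2 - R0 ^+ 2| / n%:R.
have K0 : 0 < K.
  by rewrite divr_gt0// normr_gt0 subr_eq0 eqrXn2.
have Flip e e' : (F e - F e') ^+ 2 <= K * dot (e - e') (e - e').
  exact: width_increment_lipschitz.
pose t := (r - R0) ^+ 2 / 2.
have t0 : 0 < t by rewrite divr_gt0// exprn_even_gt0//= subr_eq0.
have EF : fine ('E_P[fun w =>
  F (noise eps w)])%E = mean_width r - mean_width R0.
  rewrite unlock (_ : (\int[P]_w _ = (mean_width r - mean_width R0)%R%:E)%E)//.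
  transitivity (\int[P]_w ((width r (noise eps w))%:E - (width R0 (noise eps
    w))%:E))%E.
    by apply: eq_integral => w _; rewrite -EFinB.
  rewrite (integralB measurableT (integrable_width rr) (integrable_width
    rminR0)).
  by rewrite !mean_widthE.
have mF : measurable_fun setT (fun w => F (noise eps w)).
  exact: (measurable_lipschitz_coord K0 Flip).
apply: le_trans (le_trans (gaussian_concentration K0 Flip eps_gauss eps_indep
  t0) _).
- apply: le_measure; rewrite ?inE.
  + exact: mS.
  + exact: measurable_set_ler.
  + move=> w /= /Sr; rewrite EF /F; have := mean_width_gap rr; rewrite -/t; lra.
- rewrite lee_fin ler_expR lerN2 le_eqVlt; apply/orP; left; apply/eqP.
  rewrite /t /K; field; rewrite !gt_eqF// normr_gt0 subr_eq0 eqrXn2//.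
Qed.

Variable fhat : T -> X -> R.
Hypothesis fhat_argmin : forall w, unique_argmin (finite_penalty I)
  (penalized_loss I xs lambda (response eps xs f0 w)) (fhat w).

(** No measurability of [fhat] is assumed: by [tau_argmin_holder], [tau (fhat w)] depends
    continuously on the noise. *)
Lemma measurable_tau_fhat : measurable_fun setT (fun w => tau (fhat w)).
Proof.
apply: (measurable_fun_coord_semicontinuous (c := eps)) => // w e e0.
set A := tau (fhat w); have A0 : 0 <= A by exact: tau_ge0.
(* Chosen so that [e <= D] implies [2 * A + D <= c * D]. The stability bound then reduces to
   [D ^+ 2 <= c * de ^+ 2], which is below [e ^+ 2] for the [de] chosen next. *)
pose c := 2 * A / e + 1.
have c1 : 1 <= c by rewrite /c lerDr divr_ge0 ?(ltW e0)// mulr_ge0.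
have c0 : 0 < c by exact: lt_le_trans c1.
pose de := e / (2 * c).
have de0 : 0 < de by rewrite divr_gt0// mulr_gt0.
exists de => //.
move=> w' hw; set B := tau (fhat w').
rewrite ltNge; apply/negP => AeB.
have := tau_argmin_holder n_ge1 I_seminorm rmin_attained (fhat_argmin w)
  (fhat_argmin w').
rewrite -/A -/B; set N := dot _ _.
have hN : N <= n%:R * de ^+ 2.
  rewrite /N /dot mulr_natl -[X in _ <= _ *+ X]card_ord -sumr_const.
  apply: ler_sum => i _; rewrite !mxE -expr2 -real_normK ?num_real//.
  by rewrite lerXn2r ?nnegrE// ?(ltW de0)// ltW// hw.
set D := B - A; have eD : e <= D by rewrite /D; lra.
have D0 : 0 < D by exact: lt_le_trans eD.
have -> : B ^+ 2 - A ^+ 2 = D * (2 * A + D) by rewrite /D; ring.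
rewrite ger0_norm; last by apply: mulr_ge0; lra.
move=> h.
have cD : 2 * A + D <= c * D.
  rewrite (_ : c * D = 2 * A * D / e + D); last by rewrite /c; field;
    rewrite gt_eqF.
  by rewrite lerD2r ler_pdivlMr// ler_wpM2l// mulr_ge0.
have h2 : (D ^+ 2) ^+ 2 <= D * (c * D) * de ^+ 2.
  apply: (le_trans h); apply: (@le_trans _ _ (D * (c * D) / n%:R * (n%:R * de
    ^+ 2))).
    apply: ler_pM => //; rewrite ?dot_ge0//.
      by rewrite divr_ge0 ?(ltW n_gt0)//; apply: mulr_ge0; lra.
    by rewrite ler_wpM2r ?invr_ge0 ?(ltW n_gt0)// ler_wpM2l// ltW.
  by rewrite le_eqVlt; apply/orP; left; apply/eqP; field; rewrite gt_eqF.
have h3 : D ^+ 2 <= c * de ^+ 2.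
  rewrite -(ler_pM2l (exprn_gt0 2 D0)) -expr2; apply: (le_trans h2).
  by rewrite le_eqVlt; apply/orP; left; apply/eqP; ring.
have h4 : c * de ^+ 2 = e ^+ 2 / (4 * c) by rewrite /de; field; rewrite gt_eqF.
have h5 : e ^+ 2 / (4 * c) < e ^+ 2.
  rewrite ltr_pdivrMr ?mulr_gt0// ltr_pMr ?exprn_gt0//; lra.
have : e ^+ 2 <= D ^+ 2 by rewrite lerXn2r ?nnegrE ?(ltW e0) ?(ltW D0).
by rewrite leNgt (le_lt_trans h3)// h4.
Qed.

Let h w r := width r (noise eps w) - r ^+ 2 / 2.

Lemma fhat_maximizes w r : rmin <= r -> h w r <= h w (tau (fhat w)).
Proof. exact: argmin_tau_maximizes (fhat_argmin w) r. Qed.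

(* [h w] is concave and maximal at [tau (fhat w)], so it does not decrease on
   the way from [R0] to a point between [R0] and [tau (fhat w)]. *)
Lemma between_maximizer w r : (R0 < r <= tau (fhat w)) || (tau (fhat w) <= r <
  R0) ->
  h w R0 <= h w r.
Proof.
move=> rbtw; set A := tau (fhat w).
have dfh : finite_penalty I (fhat w) by case: (fhat_argmin w).
have rA : rmin <= A by exact: rmin_le.
pose th := (r - R0) / (A - R0).
have [AR0 th01] : A != R0 /\ 0 <= th <= 1.
  case/orP: rbtw => /andP[h1 h2].
    have AR : 0 < A - R0 by rewrite subr_gt0 (lt_le_trans h1).
    split; first by rewrite gt_eqF// -subr_gt0.
    rewrite /th divr_ge0 ?(ltW AR) ?subr_ge0 ?(ltW h1)//=.
    by rewrite ler_pdivrMr// mul1r lerD2r.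
  have AR : 0 < R0 - A by rewrite subr_gt0 (le_lt_trans h1).
  split; first by rewrite lt_eqF// -subr_gt0.
  rewrite /th -opprB -(opprB R0 A) invrN mulrNN divr_ge0 ?(ltW AR) ?subr_ge0
    ?(ltW h2)//=.
  by rewrite ler_pdivrMr// mul1r lerD2l lerN2.
have rE : r = (1 - th) * R0 + th * A.
  by rewrite /th; field; rewrite subr_eq0.
have /andP[th0 th1] := th01.
have hA := fhat_maximizes w rminR0; rewrite -/A in hA.
have := width_concave I_seminorm rmin_attained (noise eps w) th01 rminR0 rA.
rewrite -rE.
have sq : r ^+ 2 <= (1 - th) * R0 ^+ 2 + th * A ^+ 2.
  have : 0 <= th * (1 - th) * (R0 - A) ^+ 2.
    by rewrite mulr_ge0 ?sqr_ge0// mulr_ge0// subr_ge0.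
  rewrite {}rE; lra.
have := ler_wpM2l th0 hA; rewrite /h -/A; lra.
Qed.

(** The event is the union of an upper and a lower tail, treated with [r = (1 + x) * R0] and
    [r = (1 - x) * R0]. *)
Lemma tau_fhat_deviation (x : R) : 0 < R0 -> 0 < x ->
  (P [set w | (x <= `|tau (fhat w) / R0 - 1|)%R] <=
   (2 * expR (- (x ^+ 4 * (n%:R * R0 ^+ 2) / (32 * (1 + x) ^+ 2))))%:E)%E.
Proof.
move=> R0p x0; set E := expR _.
have mtau := measurable_tau_fhat.
have bound r : rmin <= r -> `|r - R0| = x * R0 ->
    expR (- (n%:R * (r - R0) ^+ 4 / (16 * `|r ^+ 2 - R0 ^+ 2|))) <= E.
  move=> rr rR0; rewrite /E ler_expR lerN2.
  have r0 : 0 <= r := le_trans (rmin_ge0 rmin_attained) rr.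
  have q : (r - R0) ^+ 4 = (x * R0) ^+ 4.
    by rewrite -rR0 -[RHS]normrX ger0_norm// exprn_even_ge0.
  have rle : r <= (1 + x) * R0.
    by have := ler_norm (r - R0); rewrite rR0; lra.
  have kE : `|r ^+ 2 - R0 ^+ 2| = x * R0 * (r + R0).
    by rewrite subr_sqr normrM rR0 ger0_norm// addr_ge0// ltW.
  have k0 : 0 < `|r ^+ 2 - R0 ^+ 2|.
    by rewrite kE !mulr_gt0// ltr_wpDl.
  (* The inequality [x * (2 + x) <= 2 * (1 + x) ^+ 2] turns the 16 of [width_deviation] into 32 and
     covers both tails. *)
  have kle : `|r ^+ 2 - R0 ^+ 2| <= 2 * (1 + x) ^+ 2 * R0 ^+ 2.
    rewrite kE; apply: (@le_trans _ _ (x * R0 * ((2 + x) * R0))).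
      by rewrite ler_wpM2l ?mulr_ge0 ?(ltW x0) ?(ltW R0p)//; lra.
    by have := sqr_ge0 R0; have := sqr_ge0 x; nra.
  rewrite ler_pdivrMr ?mulr_gt0 ?exprn_gt0 ?addr_gt0//.
  rewrite [X in _ <= X]mulrAC ler_pdivlMr ?mulr_gt0 ?exprn_gt0 ?addr_gt0// q.
  have c0 : 0 <= n%:R * x ^+ 4 * R0 ^+ 2 * 16.
    by rewrite !mulr_ge0 ?exprn_ge0 ?(ltW n_gt0) ?(ltW x0) ?(ltW R0p).
  by have := ler_wpM2l c0 kle; lra.
(* The bound [rmin <= r] is drawn from a point of the event: if [(1 - x) * R0 < rmin], the lower
   tail is empty. *)
have part (S : set T) r : measurable S -> `|r - R0| = x * R0 ->
    (forall w, S w -> rmin <= r) ->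
    (forall w, S w -> (R0 < r <= tau (fhat w)) || (tau (fhat w) <= r < R0)) ->
    (P S <= E%:E)%E.
  move=> mS rx Smin Sb; have [->|/set0P[w0 Sw0]] := eqVneq S set0.
    by rewrite measure0 lee_fin expR_ge0.
  have rr := Smin _ Sw0.
  have rR0 : r != R0.
    by apply/eqP => e; move: rx; rewrite e subrr normr0 => /esym/eqP;
      rewrite gt_eqF// mulr_gt0.
  apply: le_trans (width_deviation mS rr rR0 _) _;
    last by rewrite lee_fin bound.
  by move=> w Sw; exact: between_maximizer (Sb w Sw).
pose U := [set w | cst ((1 + x) * R0) w <= tau (fhat w)].
pose L := [set w | tau (fhat w) <= cst ((1 - x) * R0) w].
have mU : measurable U by exact: measurable_set_ler.
have mL : measurable L by exact: measurable_set_ler.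
have rtau w : rmin <= tau (fhat w).
  by apply: rmin_le; case: (fhat_argmin w).
have xR0 : 0 < x * R0 by rewrite mulr_gt0.
have PU : (P U <= E%:E)%E.
  apply: (part U ((1 + x) * R0)) => //.
  - rewrite (_ : _ - _ = x * R0); last by ring.
    by rewrite ger0_norm// mulr_ge0 ?(ltW x0) ?(ltW R0p).
  - by move=> w _; move: rminR0 xR0; lra.
  - move=> w; rewrite /U/= => ->; rewrite andbT; apply/orP; left.
    by lra.
have PL : (P L <= E%:E)%E.
  apply: (part L ((1 - x) * R0)) => //.
  - rewrite (_ : _ - _ = - (x * R0)); last by ring.
    by rewrite normrN ger0_norm// mulr_ge0 ?(ltW x0) ?(ltW R0p).
  - by move=> w; exact: le_trans (rtau w).
  - move=> w; rewrite /L/= => ->; apply/orP; right.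
    by lra.
have -> : [set w | x <= `|tau (fhat w) / R0 - 1|] = U `|` L.
  have UE w : U w = (1 + x <= tau (fhat w) / R0) by rewrite /U/= -ler_pdivlMr.
  have LE w : L w = (tau (fhat w) / R0 <= 1 - x) by rewrite /L/= -ler_pdivrMr.
  apply/seteqP; split => w; rewrite /setU/= UE LE ler_normr.
    by case/orP => ?; [left|right]; lra.
  by case=> ?; apply/orP; [left|right]; lra.
apply: (le_trans (measureU2 _ mU mL)).
by rewrite mulrDl mul1r EFinD leeD.
Qed.

End concentration.

Theorem theorem1 (R : realType) (d : measure_display) (T : measurableType d)
    (P : probability T R) (X : Type) (n : nat) (xs : 'I_n -> X)
    (I : (X -> R) -> \bar R) (f0 : X -> R) (eps : 'I_n -> {RV P >-> R})
    (lambda R0 : R) (fhat : T -> X -> R)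
    (n_ge1 : (1 <= n)%N)
    (I_seminorm : seminorm_on_domain I)
    (f0_in : finite_penalty I f0)
    (eps_gauss : forall i, standard_gaussian (eps i))
    (eps_indep : mutually_independent eps)
    (lambda_gt0 : 0 < lambda)
    (fhat_argmin : forall w, unique_argmin (finite_penalty I)
       (penalized_loss I xs lambda (response eps xs f0 w)) (fhat w))
    (Rmin_attained : exists2 f, finite_penalty I f &
       tau I xs lambda f0 f = Rmin I xs lambda f0)
    (R0_argmax : unique_argmax [set r | Rmin I xs lambda f0 <= r]
       (H eps I xs lambda f0) R0)
    (x : R) (x_gt0 : 0 < x) :
  (P [set w | (x <= `|tau I xs lambda f0 (fhat w) / R0 - 1|)%R]
   <= (3 * expR (- (x ^+ 4 * (Num.sqrt n%:R * R0) ^+ 2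
                    / (32 * (1 + x) ^+ 2))))%:E)%E.
Proof.
have n_gt0 : (0 : R) < n%:R by rewrite ltr0n.
have mtau := measurable_tau_fhat n_ge1 I_seminorm Rmin_attained fhat_argmin.
have rminR0 : Rmin I xs lambda f0 <= R0 by case: R0_argmax.
have R0_ge0 : 0 <= R0 := le_trans (rmin_ge0 Rmin_attained) rminR0.
(* At [R0 = 0] division returns 0 and the exponent vanishes, so the right-hand side is 3, above any
   probability; [mtau] makes the event measurable. *)
have [R00|R0_neq0] := eqVneq R0 0.
  rewrite R00 mulr0 expr0n/= mulr0 mul0r oppr0 expR0 mulr1.
  apply: (@le_trans _ _ 1%E); last by rewrite lee_fin ler1n.
  apply: probability_le1; apply: (@measurable_set_ler _ _ _ (cst x)) => //.
  apply: measurableT_comp => //; apply: measurable_funB => //.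
  exact: measurable_funM.
have R0_gt0 : 0 < R0 by rewrite lt_neqAle eq_sym R0_neq0.
apply: le_trans (tau_fhat_deviation n_ge1 I_seminorm Rmin_attained eps_gauss
  eps_indep R0_argmax fhat_argmin R0_gt0 x_gt0) _.
rewrite exprMn sqr_sqrtr ?(ltW n_gt0)// lee_fin ler_wpM2r ?expR_ge0//.
by rewrite ler_nat.
Qed.
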